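(* Let $V$ be a weight, $\pi$ a smooth $G(F)$-representation over $\overline{\mathbb F}_p$, $\mu\in X_*(T)_-$ and $t=\mu(\varpi)$. If $\overline T_{\mu,\varpi}$ fails to be injective on $(V\otimes_{\overline{\mathbb F}_p} \pi)^K$, then $(V'\otimes_{\overline{\mathbb F}_p} \pi)^K \neq 0$ for at least one of the irreducible constituents $V'$ of $$\ker\bigl(\mathrm{Ind}_{K\cap {}^t K}^K V^{N_{-\mu}(k)} \to V\bigr).$$
   Context: $F$ is a finite extension of $\mathbb Q_p$ with ring of integers $\mathcal O_F$, uniformiser $\varpi$ and residue field $k$; $\bar k=\overline{\mathbb F}_p$. $G_{/\mathcal O_F}$ is a split connected reductive group, $T$ a maximal split torus, $\Delta$ a system of simple roots, $K=G(\mathcal O_F)$. A weight is an (isomorphism class of) irreducible representation $V$ of $G(k)$ over $\bar k$, regarded as a $K$-representation by inflation. $X_*(T)_-=\{\mu\in X_*(T):\langle\mu,\alpha\rangle\le0\ \forall\alpha\in\Delta\}$. For $\mu\in X_*(T)$, $P_\mu=M_\mu N_\mu$ is the parabolic subgroup defined by $\mu$ (the $g$ for which $\lim_{s\to0}\mu(s)g\mu(s)^{-1}$ exists), with Levi $M_\mu\supset T$ and unipotent radical $N_\mu$. ${}^tK=tKt^{-1}$. It is known that the natural map $V^{N_{-\mu}(k)}\to V_{N_\mu(k)}$ is an isomorphism, and that the image of $K\cap{}^tK$ in $G(k)$ is $P_{-\mu}(k)$, so $K\cap{}^tK$ acts on $V^{N_{-\mu}(k)}$. The Hecke algebra $\mathcal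 H_G(V)$ consists of compactly supported $f:G(F)\to\mathrm{End}_{\bar k}V$ with $f(k_1gk_2)=k_1\circ f(g)\circ k_2$ for $k_1,k_2\in K$, under convolution. It acts on $(V\otimes\pi)^K$ by $\phi\cdot x=\sum_{\gamma\in G(F)/K}(\phi(\gamma)\otimes\gamma)x$. $\overline T_{\mu,\varpi}\in\mathcal H_G(V)$ is the element with support $K\mu(\varpi)K$ sending $\mu(\varpi)$ to the composite $V\twoheadrightarrow V_{N_\mu(k)}\xleftarrow{\sim}V^{N_{-\mu}(k)}\hookrightarrow V$. The map $\mathrm{Ind}_{K\cap{}^tK}^KV^{N_{-\mu}(k)}\to V$ is the one corresponding by Frobenius reciprocity to the inclusion $V^{N_{-\mu}(k)}\to V$. *)

(* Defs.v *)
From HB Require Import structures.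
From mathcomp Require Import all_boot all_order all_algebra all_field.
From mathcomp Require Import boolp classical_sets functions fsbigop topology.
From mathcomp Require Import freeg.

Set Implicit Arguments.
Unset Strict Implicit.
Unset Printing Implicit Defensive.

Import GRing.Theory.
Local Open Scope classical_set_scope.
Local Open Scope ring_scope.

Section PadicIntegers.
Variables (p : nat) (p_pr : prime p).

(* Z_p as the inverse limit of the rings Z/p^(n+1). *)
Record padic_int : Type := PadicInt {
  residue :> forall n, 'Z_(p ^ n.+1);
  residue_compat : forall n, residue n = (val (residue n.+1))%:R
}.

Lemma padic_intP (x y : padic_int) : (forall n, x n = y n) -> x = y.
Proof.
case: x y => [x hx] [y hy] /= xy.
have {}xy : x = y by apply: functional_extensionality_dep.
by case: y / xy hy => hy; congr PadicInt; exact: Prop_irrelevance.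
Qed.

Let pX_gt1 n : (1 < p ^ n.+1)%N.
Proof. by rewrite -[1%N](expn0 p) ltn_exp2l ?prime_gt1. Qed.

Let Zp_card n : (Zp_trunc (p ^ n.+1)).+2 = (p ^ n.+1)%N.
Proof. exact: Zp_cast. Qed.

Let Zred_mod n m : (m %% (Zp_trunc (p ^ n.+2)).+2)%:R = m%:R :> 'Z_(p ^ n.+1).
Proof.
rewrite -[LHS](Zp_nat_mod (pX_gt1 n)) -[RHS](Zp_nat_mod (pX_gt1 n)); congr _%:R.
by rewrite Zp_card modn_dvdm // dvdn_exp2l.
Qed.

Let Zred n (x : 'Z_(p ^ n.+2)) : 'Z_(p ^ n.+1) := (val x)%:R.

Let ZredD n (x y : 'Z_(p ^ n.+2)) : Zred (x + y) = Zred x + Zred y.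
Proof. by rewrite /Zred /= Zred_mod natrD. Qed.

Let ZredM n (x y : 'Z_(p ^ n.+2)) : Zred (x * y) = Zred x * Zred y.
Proof. by rewrite /Zred /= Zred_mod natrM. Qed.

Let Zred0 n : Zred (0 : 'Z_(p ^ n.+2)) = 0. Proof. by []. Qed.

Let Zred1 n : Zred (1 : 'Z_(p ^ n.+2)) = 1.
Proof. by rewrite /Zred /= Zred_mod. Qed.

Let ZredN n (x : 'Z_(p ^ n.+2)) : Zred (- x) = - Zred x.
Proof. by apply/eqP; rewrite -subr_eq0 opprK -ZredD addNr. Qed.

Definition padic_of_nat (m : nat) : padic_int.
Proof.
exists (fun n => m%:R) => n; rewrite -[LHS](Zred_mod n m); congr (_)%:R.
by rewrite [RHS](val_Zp_nat (pX_gt1 n.+1)) Zp_card.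
Defined.

Definition padic_add (x y : padic_int) : padic_int.
Proof.
exists (fun n => x n + y n) => n.
by rewrite [LHS](congr2 +%R (residue_compat x n) (residue_compat y n)) [RHS]ZredD.
Defined.

Definition padic_mul (x y : padic_int) : padic_int.
Proof.
exists (fun n => x n * y n) => n.
by rewrite [LHS](congr2 *%R (residue_compat x n) (residue_compat y n)) [RHS]ZredM.
Defined.

Definition padic_opp (x : padic_int) : padic_int.
Proof.
exists (fun n => - x n) => n.
by rewrite [LHS](congr1 -%R (residue_compat x n)) [RHS]ZredN.
Defined.

(* The primality proof is a parameter because the integral domain structure
   depends on it. *)
Definition Zp_of (_ : prime p) : Type := padic_int.
Local Notation Zp := (Zp_of p_pr).

HB.instance Definition _ := gen_eqMixin Zp.
HB.instance Definition _ := gen_choiceMixin Zp.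

Fact padic_addA : @associative Zp padic_add.
Proof. by move=> x y z; apply: padic_intP => n; exact: addrA. Qed.
Fact padic_addC : @commutative Zp Zp padic_add.
Proof. by move=> x y; apply: padic_intP => n; exact: addrC. Qed.
Fact padic_add0 : @left_id Zp Zp (padic_of_nat 0) padic_add.
Proof. by move=> x; apply: padic_intP => n; exact: add0r. Qed.
Fact padic_addN : @left_inverse Zp Zp Zp (padic_of_nat 0) padic_opp padic_add.
Proof. by move=> x; apply: padic_intP => n; exact: addNr. Qed.
HB.instance Definition _ :=
  GRing.isZmodule.Build Zp padic_addA padic_addC padic_add0 padic_addN.

Fact padic_mulA : @associative Zp padic_mul.
Proof. by move=> x y z; apply: padic_intP => n; exact: mulrA. Qed.
Fact padic_mulC : @commutative Zp Zp padic_mul.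
Proof. by move=> x y; apply: padic_intP => n; exact: mulrC. Qed.
Fact padic_mul1 : @left_id Zp Zp (padic_of_nat 1) padic_mul.
Proof. by move=> x; apply: padic_intP => n; exact: mul1r. Qed.
Fact padic_mulDl : @left_distributive Zp Zp padic_mul padic_add.
Proof. by move=> x y z; apply: padic_intP => n; exact: mulrDl. Qed.
Fact padic_1neq0 : (padic_of_nat 1 : Zp) != 0.
Proof.
apply/eqP => /(congr1 (fun x : Zp => x 0%N)) /eqP.
by rewrite /= oner_eq0.
Qed.
HB.instance Definition _ := GRing.Zmodule_isComNzRing.Build Zp
  padic_mulA padic_mulC padic_mul1 padic_mulDl padic_1neq0.

Definition padic_unit : {pred Zp} := fun x => `[< exists y : Zp, y * x = 1 >].
Definition padic_inv (x : Zp) : Zp :=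
  if pselect (exists y : Zp, y * x = 1) is left h then projT1 (cid h) else x.

Fact padic_mulV : {in padic_unit, left_inverse 1 padic_inv *%R}.
Proof.
move=> x /asboolP ux; rewrite /padic_inv.
by case: pselect => [h|//]; exact: projT2 (cid h).
Qed.
Fact padic_unitP (x y : Zp) : y * x = 1 -> padic_unit x.
Proof. by move=> yx; apply/asboolP; exists y. Qed.
Fact padic_inv_out : {in [predC padic_unit], padic_inv =1 id}.
Proof.
move=> x; rewrite inE => /asboolP ux; rewrite /padic_inv.
by case: pselect.
Qed.
HB.instance Definition _ := GRing.ComNzRing_hasMulInverse.Build Zp
  padic_mulV padic_unitP padic_inv_out.

Let residue_lt (x : Zp) n : (val (x n) < p ^ n.+1)%N.
Proof. by have := ltn_ord (x n); rewrite {2}Zp_card. Qed.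

Let residue_mod (x : Zp) m n : (m <= n)%N -> (val (x n) %% p ^ m.+1)%N = val (x m).
Proof.
elim: n => [|n IHn]; first by rewrite leqn0 => /eqP ->; exact: modn_small (residue_lt _ _).
rewrite leq_eqVlt => /predU1P[->|]; first exact: modn_small (residue_lt _ _).
rewrite ltnS => le_mn; rewrite -(IHn le_mn).
have -> : val (x n) = (val (x n.+1) %% p ^ n.+1)%N.
  by rewrite (residue_compat x n); exact: val_Zp_nat.
by rewrite modn_dvdm // dvdn_exp2l.
Qed.

Fact padic_idomain (x y : Zp) : x * y = 0 -> (x == 0) || (y == 0).
Proof.
move=> xy0; apply/norP => -[/eqP x0 /eqP y0].
have nz (z : Zp) : z <> 0 -> exists n, val (z n) <> 0%N.
  move=> z0; apply/not_existsP => h; apply: z0; apply: padic_intP => n.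
  by apply: val_inj => /=; apply: contrapT; exact: h.
have [m xm] := nz x x0; have [n yn] := nz y y0.
pose N := (m + n).+1.
have lem : (m <= N)%N by rewrite /N -addnS leq_addr.
have len : (n <= N)%N by rewrite /N -addSn leq_addl.
have := congr1 (fun z : Zp => val (z N)) xy0.
have -> : val ((x * y) N) = ((val (x N) * val (y N)) %% p ^ N.+1)%N.
  by transitivity ((val (x N) * val (y N)) %% (Zp_trunc (p ^ N.+1)).+2)%N;
    [by []|congr modn; exact: Zp_card].
move=> /eqP dvd.
have xN : ~~ (p ^ m.+1 %| val (x N))%N by apply/negP => /eqP; rewrite (residue_mod x lem).
have yN : ~~ (p ^ n.+1 %| val (y N))%N by apply/negP => /eqP; rewrite (residue_mod y len).
have gt0 k a : ~~ (p ^ k.+1 %| a)%N -> (0 < a)%N by case: a => //; rewrite dvdn0.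
have x_gt0 := gt0 _ _ xN; have y_gt0 := gt0 _ _ yN.
have := dvd; rewrite -[_ == _]/(p ^ N.+1 %| val (x N) * val (y N))%N.
rewrite pfactor_dvdn ?muln_gt0 ?x_gt0 // lognM // leqNgt => /negP; apply.
move: xN yN; rewrite !pfactor_dvdn // -!ltnNge !ltnS => hx hy.
by apply: leq_trans (leq_add hx hy) _; rewrite /N leqnSn.
Qed.
HB.instance Definition _ := GRing.ComUnitRing_isIntegral.Build Zp padic_idomain.

End PadicIntegers.

Notation Qp p_pr := {fraction (Zp_of p_pr)}.

Section RingOfIntegers.
Variables (p : nat) (p_pr : prime p) (F : fieldExtType (Qp p_pr)).

Definition Zp_in : {rmorphism Zp_of p_pr -> F} :=
  in_alg F \o @FracField.tofrac (Zp_of p_pr).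

Definition integral_over_Zp : {pred F} := fun x => `[< integralOver Zp_in x >].

Fact integral_over_Zp_subring : subring_closed integral_over_Zp.
Proof.
split=> [|x y /asboolP hx /asboolP hy|x y /asboolP hx /asboolP hy]; apply/asboolP.
- exact: integral1.
- exact: integral_sub.
- exact: integral_mul.
Qed.
HB.instance Definition _ :=
  GRing.isSubringClosed.Build F integral_over_Zp integral_over_Zp_subring.

Definition integers : Type := {x : F | x \in integral_over_Zp}.
HB.instance Definition _ := [isSub of integers for sval].
HB.instance Definition _ := [Choice of integers by <:].
HB.instance Definition _ := [SubChoice_isSubComNzRing of integers by <:].

Definition int_incl : {rmorphism integers -> F} := (val : integers -> F).

(* A generator of the maximal ideal, i.e. of the set of non-units. *)
Definition uniformizer (w : integers) : Prop :=
  w != 0 /\ forall x : integers, ~ (exists y, x * y = 1) <-> exists y, x = w * y.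

(* Any surjection onto a field whose kernel is the set of non-units presents
   its target as the residue field. *)
Definition residue_field_map (k : fieldType) (red : {rmorphism integers -> k}) : Prop :=
  (forall a, exists x, red x = a) /\
  (forall x, red x = 0 <-> ~ (exists y, x * y = 1)).

End RingOfIntegers.

Section Algebras.
Variables (R S : comNzRingType) (s : {rmorphism R -> S}).

(* The ring S seen as an R-algebra through s. *)
Definition alg_along (_ : {rmorphism R -> S}) : Type := S.
Local Notation A := (alg_along s).

HB.instance Definition _ := GRing.ComNzRing.on A.

Fact along_scaleA (a b : R) (v : A) : s a * (s b * v) = s (a * b) * v.
Proof. by rewrite rmorphM mulrA. Qed.
Fact along_scale1 : @left_id R A 1 (fun a v => s a * v).
Proof. by move=> v; rewrite rmorph1 mul1r. Qed.
Fact along_scaleDr : @right_distributive R A (fun a v => s a * v) +%R.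
Proof. by move=> a u v; rewrite mulrDr. Qed.
Fact along_scaleDl (v : A) : {morph (fun a : R => s a * v : A) : a b / a + b}.
Proof. by move=> a b; rewrite rmorphD mulrDl. Qed.
HB.instance Definition _ := GRing.Zmodule_isLmodule.Build R A
  along_scaleA along_scale1 along_scaleDr along_scaleDl.

Fact along_scaleAl (a : R) (u v : A) : a *: (u * v) = a *: u * v.
Proof. exact: mulrA. Qed.
HB.instance Definition _ := GRing.Lmodule_isLalgebra.Build R A along_scaleAl.
HB.instance Definition _ := GRing.Lalgebra_isComAlgebra.Build R A.
End Algebras.

Section StructureMap.
Variables (R S : comNzRingType) (s : {rmorphism R -> S}).

Definition structure_map : R^o -> alg_along s := s.
HB.instance Definition _ := GRing.RMorphism.copy structure_map s.
Fact structure_map_scalable : scalable structure_map.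
Proof. by move=> a x; rewrite /structure_map rmorphM. Qed.
HB.instance Definition _ :=
  GRing.isScalable.Build R R^o (alg_along s) *:%R structure_map structure_map_scalable.
End StructureMap.

Section AlongMap.
Variables (R S S' : comNzRingType) (s : {rmorphism R -> S}) (f : {rmorphism S -> S'}).

Definition along_map : alg_along s -> alg_along (f \o s) := f.
HB.instance Definition _ := GRing.RMorphism.copy along_map f.
Fact along_map_scalable : scalable along_map.
Proof. by move=> a x; rewrite /along_map [LHS](rmorphM f). Qed.
HB.instance Definition _ :=
  GRing.isScalable.Build R (alg_along s) (alg_along (f \o s)) *:%R
    along_map along_map_scalable.
End AlongMap.
Arguments along_map {R S S'} s f.

Section Gm.
Variable S : comNzRingType.

(* G_m(S): pairs (u, u^-1), which makes sense without a unitRing structure. *)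
Definition units : Type := {u : S * S | u.1 * u.2 == 1}.
HB.instance Definition _ := [isSub of units for sval].
HB.instance Definition _ := [Choice of units by <:].

Definition uval (u : units) : S := (val u).1.

Lemma units_inj : injective uval.
Proof.
move=> u v uv; apply: val_inj.
have := eqP (valP u); have := eqP (valP v); move: uv; rewrite /uval.
case: (val u) (val v) => [x x'] [y y'] /= -> yy' yx'.
by congr pair; rewrite -[x']mulr1 -yy' mulrCA mulrA yx' mul1r.
Qed.

Fact units_one_subproof : (1 : S, 1 : S).1 * (1 : S, 1 : S).2 == 1.
Proof. by rewrite mulr1. Qed.
Definition units_one : units := Sub (1, 1) units_one_subproof.

Fact units_inv_subproof (u : units) : (val u).2 * (val u).1 == 1.
Proof. by rewrite mulrC (valP u). Qed.
Definition units_inv (u : units) : units :=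
  Sub ((val u).2, (val u).1) (units_inv_subproof u).

Fact units_mul_subproof (u v : units) :
  ((val u).1 * (val v).1) * ((val u).2 * (val v).2) == 1.
Proof. by rewrite mulrACA (eqP (valP u)) (eqP (valP v)) mulr1. Qed.
Definition units_mul (u v : units) : units :=
  Sub ((val u).1 * (val v).1, (val u).2 * (val v).2) (units_mul_subproof u v).

Fact units_mulA : associative units_mul.
Proof. by move=> u v w; apply: units_inj; exact: mulrA. Qed.
Fact units_mul1 : left_id units_one units_mul.
Proof. by move=> u; apply: units_inj; exact: mul1r. Qed.
Fact units_mulr1 : right_id units_one units_mul.
Proof. by move=> u; apply: units_inj; exact: mulr1. Qed.
Fact units_mulV : left_inverse units_one units_inv units_mul.
Proof. by move=> u; apply: units_inj; apply/eqP; rewrite /uval /= mulrC (valP u). Qed.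
Fact units_mulrV : right_inverse units_one units_inv units_mul.
Proof. by move=> u; apply: units_inj; apply/eqP; exact: valP u. Qed.
HB.instance Definition _ := isGroup.Build units
  units_mulA units_mul1 units_mulr1 units_mulV units_mulrV.

Lemma unitsC (u v : units) : (u * v = v * u)%g.
Proof. by apply: units_inj; exact: mulrC. Qed.

End Gm.

Fact units_map_subproof (S S' : comNzRingType) (f : {rmorphism S -> S'}) (u : units S) :
  f (val u).1 * f (val u).2 == 1.
Proof. by rewrite -rmorphM (eqP (valP u)) rmorph1. Qed.
Definition units_map (S S' : comNzRingType) (f : {rmorphism S -> S'}) (u : units S) :
  units S' := Sub (f (val u).1, f (val u).2) (units_map_subproof f u).

(* Used only for x != 0; the value at 0 is the neutral element. *)
Definition unit_of (L : fieldType) (x : L) : units L := insubd (1%g : units L) (x, x^-1).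

Definition zexp (H : groupType) (x : H) (n : int) : H :=
  match n with Posz m => (x ^+ m)%g | Negz m => (x ^- m.+1)%g end.

(* An affine group scheme over R, given by its coordinate algebra A and a group
   structure on Hom_{R-alg}(A, S), functorial in the R-algebra S. By Yoneda this
   is the same thing as a commutative Hopf algebra structure on A. *)
Record group_scheme (R : comNzRingType) : Type := GroupScheme {
  coord :> comAlgType R;
  gs_mul : forall S : comAlgType R,
    {lrmorphism coord -> S} -> {lrmorphism coord -> S} -> {lrmorphism coord -> S};
  gs_one : forall S : comAlgType R, {lrmorphism coord -> S};
  gs_inv : forall S : comAlgType R, {lrmorphism coord -> S} -> {lrmorphism coord -> S};
  gs_mulA : forall S, associative (@gs_mul S);
  gs_mul1 : forall S, left_id (gs_one S) (@gs_mul S);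
  gs_mulr1 : forall S, right_id (gs_one S) (@gs_mul S);
  gs_mulV : forall S, left_inverse (gs_one S) (@gs_inv S) (@gs_mul S);
  gs_mulrV : forall S, right_inverse (gs_one S) (@gs_inv S) (@gs_mul S);
  gs_natural : forall (S S' : comAlgType R) (f : {lrmorphism S -> S'})
      (x y : {lrmorphism coord -> S}),
    f \o gs_mul x y = gs_mul (f \o x) (f \o y) :> {lrmorphism coord -> S'}
}.

Definition points (R : comNzRingType) (G : group_scheme R) (S : comAlgType R) : Type :=
  {lrmorphism G -> S}.

Section Points.
Variables (R : comNzRingType) (G : group_scheme R) (S : comAlgType R).
HB.instance Definition _ := gen_eqMixin (points G S).
HB.instance Definition _ := gen_choiceMixin (points G S).
HB.instance Definition _ := isGroup.Build (points G S) (@gs_mulA _ G S)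
  (@gs_mul1 _ G S) (@gs_mulr1 _ G S) (@gs_mulV _ G S) (@gs_mulrV _ G S).
End Points.

Definition point_map (R : comNzRingType) (G : group_scheme R) (S S' : comAlgType R)
  (f : {lrmorphism S -> S'}) (x : points G S) : points G S' :=
  (f \o (x : {lrmorphism G -> S}) : {lrmorphism G -> S'}).

(* The value of the function a at the S-point x. *)
Definition coord_at (R : comNzRingType) (G : group_scheme R) (S : comAlgType R)
  (a : G) (x : points G S) : S := (x : {lrmorphism G -> S}) a.

(* An algebra map from the coordinate ring of G to that of H is a morphism of
   schemes from H to G. *)
Section SchemeMaps.
Variables (R : comNzRingType) (G H : group_scheme R) (j : {lrmorphism G -> H}).

Definition on_points (S : comAlgType R) (x : points H S) : points G S :=
  ((x : {lrmorphism H -> S}) \o j : {lrmorphism G -> S}).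

Definition is_group_hom : Prop :=
  forall (S : comAlgType R) (x y : points H S),
    on_points (x * y)%g = (on_points x * on_points y)%g.

Definition closed_immersion : Prop := forall a : H, exists b : G, j b = a.
End SchemeMaps.

Section Tori.
Variables (R : comNzRingType) (T : group_scheme R).

Record cochar : Type := Cochar {
  cochar_at :> forall S : comAlgType R, units S -> points T S;
  cochar_mul : forall (S : comAlgType R) (u v : units S),
    cochar_at (u * v)%g = (cochar_at u * cochar_at v)%g;
  cochar_natural : forall (S S' : comAlgType R) (f : {lrmorphism S -> S'}) (u : units S),
    point_map f (cochar_at u) = cochar_at (units_map f u)
}.

Record character : Type := Char {
  char_at :> forall S : comAlgType R, points T S -> units S;
  char_mul : forall (S : comAlgType R) (x y : points T S),
    char_at (x * y)%g = (char_at x * char_at y)%g;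
  char_natural : forall (S S' : comAlgType R) (f : {lrmorphism S -> S'}) (x : points T S),
    units_map f (char_at x) = char_at (point_map f x)
}.

Definition cochar_opp (mu : cochar) : cochar.
Proof.
exists (fun S u => mu S (u^-1)%g) => [S u v|S S' f u].
- by rewrite -cochar_mul; congr cochar_at; rewrite unitsC; apply: units_inj; exact: mulrC.
- by rewrite cochar_natural; congr cochar_at; exact: units_inj.
Defined.

(* <mu, alpha> = n, i.e. alpha \o mu is u |-> u^n. *)
Definition pairing_is (mu : cochar) (alpha : character) (n : int) : Prop :=
  forall (S : comAlgType R) (u : units S), alpha S (mu S u) = zexp u n.

(* T is isomorphic to G_m^r, by a family of r characters. *)
Definition split_torus : Prop :=
  exists (r : nat) (chi : 'I_r -> character),
    forall (S : comAlgType R) (u : 'I_r -> units S),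
      exists! x : points T S, forall i, chi i S x = u i.

End Tori.

(* L-points of G viewed as a classical algebraic group. These notions are used
   for L algebraically closed, where a smooth G_L is determined by G(L) with its
   regular functions. *)
Section GeometricPoints.
Variables (R : comNzRingType) (G : group_scheme R) (L : fieldType) (s : {rmorphism R -> L}).
Local Notation GL := (points G (alg_along s)).

Definition regular (f : GL -> L) : Prop :=
  exists cs : seq (L * G), forall x, f x = \sum_(ca <- cs) ca.1 * coord_at ca.2 x.

Definition zariski_closed (Z : set GL) : Prop :=
  exists I : set (GL -> L), (forall f, I f -> regular f) /\
    (forall x, Z x <-> forall f, I f -> f x = 0).

Definition zariski_connected (Z : set GL) : Prop :=
  Z !=set0 /\
  forall A B, zariski_closed A -> zariski_closed B ->
    A `|` B = Z -> A `&` B = set0 -> A = set0 \/ B = set0.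

Definition subgroup (H : groupType) (U : set H) : Prop :=
  [/\ U 1%g, forall x y, U x -> U y -> U (x * y)%g & forall x, U x -> U (x^-1)%g].

(* Right translation by u is unipotent on every regular function. *)
Definition unipotent (u : GL) : Prop :=
  forall f, regular f -> exists n,
    forall x, iter n (fun h y => h (y * u)%g - h y) f x = 0.

(* Closed connected unipotent normal subgroups of P. *)
Definition unipotent_normal (P U : set GL) : Prop :=
  [/\ subgroup U, U `<=` P, zariski_closed U, zariski_connected U
    & (forall u, U u -> unipotent u) /\
      (forall x u, P x -> U u -> U (x * u * x^-1)%g)].

Definition is_unipotent_radical (P U : set GL) : Prop :=
  unipotent_normal P U /\ forall U', unipotent_normal P U' -> U' `<=` U.

Definition connected_reductive : Prop :=
  zariski_connected [set: GL] /\ is_unipotent_radical [set: GL] [set 1%g].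

(* The z i form an isomorphism of algebraic groups from H onto G_m^m: they are
   multiplicative, bijective onto G_m(L)^m, and every regular function on H is a
   Laurent polynomial in them. *)
Definition torus (H : set GL) : Prop :=
  [/\ subgroup H, zariski_closed H &
  exists (m : nat) (z : 'I_m -> GL -> L),
    [/\ forall i, regular (z i),
        forall i x y, H x -> H y -> z i (x * y)%g = z i x * z i y,
        forall c : 'I_m -> L, (forall i, c i != 0) ->
          exists! x, H x /\ forall i, z i x = c i,
        forall i x, H x -> z i x != 0 &
        forall f, regular f -> exists cs : seq (L * ('I_m -> int)),
          forall x, H x -> f x = \sum_(ce <- cs) ce.1 * \prod_(i < m) z i x ^ ce.2 i]].

Definition maximal_torus (H : set GL) : Prop :=
  torus H /\ forall H', torus H' -> H `<=` H' -> H' = H.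

(* Derivations at the identity of the algebra of regular functions, i.e.
   elements of Lie(G_L). *)
Definition tangent_vector (D : (GL -> L) -> L) : Prop :=
  forall f g, regular f -> regular g ->
    (forall c : L, D (fun x => c * f x + g x) = c * D f + D g) /\
    D (fun x => f x * g x) = f 1%g * D g + D f * g 1%g.

End GeometricPoints.

Section Reductive.
Variables (R : comNzRingType).

Definition finite_type (A : comAlgType R) : Prop :=
  exists gens : seq A, forall B : set A,
    (forall a, a \in gens -> B a) -> (forall c : R, B (c *: 1)) ->
    (forall a b, B a -> B b -> B (a + b)) -> (forall a b, B a -> B b -> B (a * b)) ->
    B = [set: A].

(* Infinitesimal lifting along surjections with square-zero kernel. *)
Definition formally_smooth (A : comAlgType R) : Prop :=
  forall (S S' : comAlgType R) (q : {lrmorphism S -> S'}),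
    (forall b, exists a, q a = b) ->
    (forall a b, q a = 0 -> q b = 0 -> a * b = 0) ->
    forall x' : {lrmorphism A -> S'}, exists x : {lrmorphism A -> S},
      forall a, q (x a) = x' a.

(* Connected reductive group schemes over a Noetherian base, where finite type
   and finite presentation agree: smooth, with connected reductive geometric
   fibres. *)
Definition reductive (G : group_scheme R) : Prop :=
  [/\ finite_type G, formally_smooth G &
      forall (L : closedFieldType) (s : {rmorphism R -> L}), connected_reductive G s].

Definition split_maximal_torus (G T : group_scheme R) (j : {lrmorphism G -> T}) : Prop :=
  [/\ is_group_hom j, closed_immersion j, split_torus T &
      forall (L : closedFieldType) (s : {rmorphism R -> L}),
        @maximal_torus _ G L s (range (@on_points _ _ _ j (alg_along s)))].

(* Nontrivial characters alpha such that Ad(x) D = alpha(x) D for all x in T(L)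
   and some nonzero D in Lie(G_L). *)
Definition is_root (G T : group_scheme R) (j : {lrmorphism G -> T})
    (alpha : character T) : Prop :=
  ~ (forall S (x : points T S), alpha S x = 1%g) /\
  forall (L : closedFieldType) (s : {rmorphism R -> L}),
    exists D : (points G (alg_along s) -> L) -> L,
      [/\ tangent_vector D, exists2 f, regular f & D f <> 0 &
          forall (x : points T (alg_along s)) f, regular f ->
            let g := on_points j x in
            D (fun y => f (g * y * g^-1)%g) = uval (alpha _ x) * D f].

(* Delta is a base of the root system: linearly independent roots such that every
   root is a nonnegative or a nonpositive integral combination. *)
Definition simple_roots (G T : group_scheme R) (j : {lrmorphism G -> T})
    (l : nat) (Delta : 'I_l -> character T) : Prop :=
  [/\ forall i, is_root j (Delta i),
      forall n : 'I_l -> int,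
        (forall S (x : points T S), (\prod_(i < l) zexp (Delta i S x) (n i) = 1)%g) ->
        forall i, n i = 0 &
      forall alpha, is_root j alpha -> exists n : 'I_l -> int,
        ((forall i, 0 <= n i) \/ (forall i, n i <= 0)) /\
        forall S (x : points T S),
          alpha S x = (\prod_(i < l) zexp (Delta i S x) (n i))%g].

Definition antidominant (T : group_scheme R) (l : nat) (Delta : 'I_l -> character T)
    (mu : cochar T) : Prop :=
  forall i, exists2 n : int, n <= 0 & pairing_is mu (Delta i) n.

Section Parabolic.
Variables (G T : group_scheme R) (j : {lrmorphism G -> T}) (mu : cochar T).
Variables (L : fieldType) (s : {rmorphism R -> L}).

Definition to_poly : {rmorphism L -> {poly L}} := polyC.
Definition to_ratfun : {rmorphism {poly L} -> {fraction {poly L}}} := @FracField.tofrac _.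

(* P_mu(L): the limit of mu(X) g mu(X)^-1 at X = 0 exists if and only if this
   L(X)-point of G is defined over L[X]. *)
Definition parabolic : set (points G (alg_along s)) := [set g |
  exists h : points G (alg_along (to_poly \o s)),
    let x := on_points j (mu (alg_along (to_ratfun \o (to_poly \o s)))
               (unit_of (to_ratfun 'X))) in
    point_map (along_map _ to_ratfun) h =
    (x * point_map (along_map _ to_ratfun) (point_map (along_map _ to_poly) g) * x^-1)%g].
End Parabolic.
End Reductive.
Arguments parabolic {R G T} j mu {L} s.

Section QuotientModule.
Variables (C : fieldType) (M : lmodType C).

Definition submod (W : set M) : Prop :=
  W 0 /\ forall (a : C) u v, W u -> W v -> W (a *: u + v).

Variable X : set M.

Definition lin_span : {pred M} :=
  fun x => `[< forall W, submod W -> X `<=` W -> W x >].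

Lemma lin_span_submod a u v : u \in lin_span -> v \in lin_span -> a *: u + v \in lin_span.
Proof.
move=> /asboolP hu /asboolP hv; apply/asboolP => W sW XW.
by apply: sW.2; [exact: hu|exact: hv].
Qed.

Fact lin_span_zmod : zmod_closed lin_span.
Proof.
split=> [|u v hu hv]; first by apply/asboolP => W [].
by rewrite addrC -scaleN1r lin_span_submod.
Qed.
HB.instance Definition _ := GRing.isZmodClosed.Build M lin_span lin_span_zmod.

Definition quot_mod : Type := Quotient.quot lin_span.
HB.instance Definition _ := GRing.Zmodule.on quot_mod.

Definition quot_proj (x : M) : quot_mod := \pi_(Quotient.quot lin_span)%qT x.

Lemma quot_projP x y : quot_proj x = quot_proj y <-> x - y \in lin_span.
Proof.
have -> : (x - y \in lin_span) = (quot_proj x == quot_proj y).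
  by rewrite (Quotient.idealrBE (lin_span : zmodClosed M)).
by split=> /eqP.
Qed.

Lemma quot_projB x y : quot_proj (x - y) = quot_proj x - quot_proj y.
Proof. by rewrite /quot_proj !piE. Qed.
Lemma quot_projD x y : quot_proj (x + y) = quot_proj x + quot_proj y.
Proof. by rewrite /quot_proj !piE. Qed.

Definition quot_repr (x : quot_mod) : M := repr (x : (Quotient.quot lin_span)).
Lemma quot_reprK x : quot_proj (quot_repr x) = x.
Proof. exact: reprK. Qed.

Definition quot_scale (a : C) (x : quot_mod) : quot_mod := quot_proj (a *: quot_repr x).

Lemma quot_projZ a x : quot_proj (a *: x) = quot_scale a (quot_proj x).
Proof.
apply/quot_projP; rewrite -scalerBr -[_ *: _]addr0; apply: lin_span_submod.
  by apply/quot_projP; rewrite quot_reprK.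
exact: (rpred0 (lin_span : zmodClosed M)).
Qed.

Fact quot_scaleA a b x : quot_scale a (quot_scale b x) = quot_scale (a * b) x.
Proof. by rewrite -[x]quot_reprK -!quot_projZ scalerA. Qed.
Fact quot_scale1 : left_id 1 quot_scale.
Proof. by move=> x; rewrite -[x in LHS]quot_reprK -quot_projZ scale1r quot_reprK. Qed.
Fact quot_scaleDr : right_distributive quot_scale +%R.
Proof.
move=> a x y; rewrite -[x]quot_reprK -[y]quot_reprK -quot_projD -!quot_projZ.
by rewrite scalerDr quot_projD.
Qed.
Fact quot_scaleDl x : {morph quot_scale^~ x : a b / a + b}.
Proof. by move=> a b; rewrite -[x]quot_reprK -!quot_projZ scalerDl quot_projD. Qed.
HB.instance Definition _ := GRing.Zmodule_isLmodule.Build C quot_mod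
  quot_scaleA quot_scale1 quot_scaleDr quot_scaleDl.

End QuotientModule.

Section Tensor.
Variables (C : fieldType).

(* The usual relations on the free module on V * W. *)
Definition tensor_rel (V W : lmodType C) : set {freeg (V * W) / C} := [set r |
  [\/ exists v v' w, r = << (v + v', w) >> - << (v, w) >> - << (v', w) >>,
      exists v w w', r = << (v, w + w') >> - << (v, w) >> - << (v, w') >>,
      exists a v w, r = << (a *: v, w) >> - a *: << (v, w) >> |
      exists a v w, r = << (v, a *: w) >> - a *: << (v, w) >>]].

Definition tensor (V W : lmodType C) : lmodType C := quot_mod (@tensor_rel V W).

Definition tens (V W : lmodType C) (v : V) (w : W) : tensor V W :=
  quot_proj _ << (v, w) >>.

Definition tensor_map (V W V' W' : lmodType C) (f : V -> V') (g : W -> W')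
    (x : tensor V W) : tensor V' W' :=
  fglift (fun vw => tens (f vw.1) (g vw.2)) (quot_repr x).

Lemma tensDl (V W : lmodType C) (v v' : V) (w : W) : tens (v + v') w = tens v w + tens v' w.
Proof.
rewrite /tens -quot_projD; apply/quot_projP; rewrite opprD addrA.
by apply/asboolP => U _; apply; constructor 1; exists v, v', w.
Qed.

Lemma tensDr (V W : lmodType C) (v : V) (w w' : W) : tens v (w + w') = tens v w + tens v w'.
Proof.
rewrite /tens -quot_projD; apply/quot_projP; rewrite opprD addrA.
by apply/asboolP => U _; apply; constructor 2; exists v, w, w'.
Qed.

Lemma tensZl (V W : lmodType C) a (v : V) (w : W) : tens (a *: v) w = a *: tens v w.
Proof.
apply/esym; rewrite /tens [LHS](esym (quot_projZ _ _ _)); apply/esym/quot_projP.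
by apply/asboolP => U _; apply; constructor 3; exists a, v, w.
Qed.

Lemma tensZr (V W : lmodType C) a (v : V) (w : W) : tens v (a *: w) = a *: tens v w.
Proof.
apply/esym; rewrite /tens [LHS](esym (quot_projZ _ _ _)); apply/esym/quot_projP.
by apply/asboolP => U _; apply; constructor 4; exists a, v, w.
Qed.

Lemma fgliftZD (K : choiceType) (M : lmodType C) (h : K -> M) a (D E : {freeg K / C}) :
  fglift h (a *: D + E) = a *: fglift h D + fglift h E.
Proof.
pose lB := @lift_is_additive C K M h.
have l0 : fglift h 0 = 0 by have := lB 0 0; rewrite !subrr.
have lD x y : fglift h (x + y) = fglift h x + fglift h y.
  by rewrite -[y in LHS]opprK lB -[- y]sub0r lB l0 sub0r opprK.
rewrite lD; congr (_ + _).
elim/freeg_ind_dom0: D => [|k x D _ _ IH]; first by rewrite scaler0 l0 scaler0.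
rewrite scalerDr !lD IH scalerDr; congr (_ + _).
have -> : a *: << k *g x >> = << (a * k) *g x >>.
  by apply/eqP/freeg_eqP => z; rewrite coeffZ !coeffU mulrA.
by rewrite !liftU scalerA.
Qed.

Section TensorMap.
Variables (V W V' W' : lmodType C) (f : {linear V -> V'}) (g : {linear W -> W'}).
Let h (vw : V * W) := tens (f vw.1) (g vw.2).

Let lift_eq D E : quot_proj (tensor_rel (W:=W)) D = quot_proj (tensor_rel (W:=W)) E ->
  fglift h D = fglift h E.
Proof.
have lB := @lift_is_additive C _ _ h.
have l0 : fglift h 0 = 0 by have := lB 0 0; rewrite !subrr.
move=> /quot_projP /asboolP DE; apply/eqP; rewrite -subr_eq0 -lB.
apply/eqP; apply: (DE [set x | fglift h x = 0]) => [|r].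
  split=> [|a u v /= hu hv]; first exact: l0.
  by rewrite fgliftZD hu hv scaler0 addr0.
have lZ a D' : fglift h (a *: D') = a *: fglift h D'.
  have := fgliftZD h a D' 0; rewrite !addr0 => ->.
  by rewrite l0 addr0.
have h1 vw : fglift h << vw >> = h vw by rewrite liftU scale1r.
case=> [[v [v' [w ->]]]|[v [w [w' ->]]]|[a [v [w ->]]]|[a [v [w ->]]]] /=.
- by rewrite !lB !h1 /h /= linearD tensDl addrAC addrK subrr.
- by rewrite !lB !h1 /h /= linearD tensDr addrAC addrK subrr.
- by rewrite lB lZ !h1 /h /= linearZ tensZl subrr.
- by rewrite lB lZ !h1 /h /= linearZ tensZr subrr.
Qed.

Lemma tensor_mapE v w : tensor_map f g (tens v w) = tens (f v) (g w).
Proof.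
rewrite /tensor_map -/h (@lift_eq _ << (v, w) >>) ?quot_reprK //.
by rewrite liftU scale1r.
Qed.

Lemma tensor_map_linear : linear (tensor_map f g).
Proof.
move=> a x y; rewrite /tensor_map -/h -fgliftZD; apply: lift_eq.
by rewrite quot_reprK quot_projD quot_projZ !quot_reprK.
Qed.
End TensorMap.

Lemma tensor_ind (V W : lmodType C) (P : tensor V W -> Prop) :
  P 0 -> (forall v w x, P x -> P (tens v w + x)) -> forall x, P x.
Proof.
move=> P0 PD x; rewrite -[x]quot_reprK.
elim/freeg_ind_dom0: (quot_repr x) => [|k vw D _ _ IH].
  by have := quot_projB (@tensor_rel V W) 0 0; rewrite !subrr => ->.
rewrite quot_projD.
have -> : quot_proj (tensor_rel (W:=W)) << k *g vw >> = tens (k *: vw.1) vw.2.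
  rewrite tensZl /tens -[in RHS]surjective_pairing; apply/esym.
  rewrite [LHS](esym (quot_projZ _ _ _)); congr quot_proj.
  by apply/eqP/freeg_eqP => z; rewrite coeffZ !coeffU mul1r.
exact: PD.
Qed.
End Tensor.

Section LocalPoints.
Variables (p : nat) (p_pr : prime p) (F : fieldExtType (Qp p_pr)).
Variable G : group_scheme (integers F).

Definition local_points : Type := points G (alg_along (int_incl F)).
HB.instance Definition _ := Group.on local_points.

Definition local_coord (a : G) (g : local_points) : F := coord_at a g.

Definition padic_close (m : nat) (x y : F) : Prop :=
  exists c : integers F, x - y = p%:R ^+ m * int_incl F c.

(* The topology on G(F) induced by the coordinate functions G(F) -> F, the sets
   p^m O_F being a basis of neighbourhoods of 0 in F. *)
Definition local_open : set_system local_points := [set U |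
  forall g, U g -> exists (s : seq G) (m : nat), forall h : local_points,
    (forall a, a \in s ->
       padic_close m (local_coord a h) (local_coord a g)) -> U h].

Lemma padic_close_le m n x y : (m <= n)%N -> padic_close n x y -> padic_close m x y.
Proof.
move=> le_mn [c xy]; exists (p%:R ^+ (n - m) * c).
by rewrite xy rmorphM rmorphXn rmorph_nat mulrA -exprD subnKC.
Qed.

Fact local_openT : local_open setT.
Proof. by move=> g _; exists [::], 0%N. Qed.

Fact local_openI : setI_closed local_open.
Proof.
move=> U U' oU oU' g [Ug U'g].
have [s [m hU]] := oU g Ug; have [s' [m' hU']] := oU' g U'g.
exists (s ++ s'), (maxn m m') => h gh; split; [apply: hU|apply: hU'] => a ha.
- by apply: padic_close_le (gh a _); rewrite ?leq_maxl // mem_cat ha.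
- by apply: padic_close_le (gh a _); rewrite ?leq_maxr // mem_cat ha orbT.
Qed.

Fact local_open_bigU (I : Type) (f : I -> set local_points) :
  (forall i, local_open (f i)) -> local_open (\bigcup_i f i).
Proof.
move=> of_ g [i _ fig]; have [s [m hs]] := of_ i g fig.
by exists s, m => h /hs fih; exists i.
Qed.

HB.instance Definition _ := isOpenTopological.Build local_points
  local_openT local_openI local_open_bigU.

Definition integral_points : Type := points G (integers F)^o.
HB.instance Definition _ := Group.on integral_points.

Definition int_to_local (h : integral_points) : local_points :=
  point_map (structure_map (int_incl F)) h.

Definition K_double_coset (t : local_points) : set local_points :=
  [set g | exists h h', g = (int_to_local h * t * int_to_local h')%g].

Definition K_cap_conj (t : local_points) : set integral_points :=
  [set h | exists h', int_to_local h = (t * int_to_local h' * t^-1)%g].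

Definition left_K_cosets : set (set local_points) :=
  [set c | exists g, c = [set (g * int_to_local h)%g | h in setT]].
End LocalPoints.

Section Representations.
Variables (C : fieldType) (H : groupType).

Definition is_rep (V : lmodType C) (rho : H -> {linear V -> V}) : Prop :=
  (forall v, rho 1%g v = v) /\ (forall g h v, rho (g * h)%g v = rho g (rho h v)).

Definition irreducible_rep (V : lmodType C) (rho : H -> {linear V -> V}) : Prop :=
  is_rep rho /\ (exists v : V, v <> 0) /\
  forall W : set V, submod W -> (forall h v, W v -> W (rho h v)) ->
    W = [set 0] \/ W = setT.

Definition fixed (V : lmodType C) (rho : H -> {linear V -> V}) (N : set H) : set V :=
  [set v | forall n, N n -> rho n v = v].

Definition coinv_rel (V : lmodType C) (rho : H -> {linear V -> V}) (N : set H) : set V :=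
  [set x | exists n v, N n /\ x = rho n v - v].

Definition coinv (V : lmodType C) (rho : H -> {linear V -> V}) (N : set H) : lmodType C :=
  quot_mod (coinv_rel rho N).

Definition to_coinv (V : lmodType C) (rho : H -> {linear V -> V}) (N : set H) (v : V) :
  coinv rho N := quot_proj (coinv_rel rho N) v.

Definition tensor_fixed (V W : lmodType C) (rho : H -> {linear V -> V})
    (sigma : H -> {linear W -> W}) : set (tensor V W) :=
  [set x | forall h, tensor_map (rho h) (sigma h) x = x].

(* V is an irreducible subquotient of the subrepresentation M0 of M: a quotient of
   some subrepresentation X of M0. The representation is given by its action on M. *)
Definition irreducible_constituent (M : lmodType C) (act : H -> M -> M) (M0 : set M)
    (V : lmodType C) (rho : H -> {linear V -> V}) : Prop :=
  irreducible_rep rho /\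
  exists (X : set M) (q : M -> V),
    [/\ submod X /\ X `<=` M0, forall h x, X x -> X (act h x),
        forall a x y, X x -> X y -> q (a *: x + y) = a *: q x + q y,
        forall h x, X x -> q (act h x) = rho h (q x) &
        forall v, exists2 x, X x & q x = v].
End Representations.

Section Hecke.
Variables (p : nat) (p_pr : prime p) (F : fieldExtType (Qp p_pr)).
Variables (k : finFieldType) (red : {rmorphism integers F -> k}).
Variables (G : group_scheme (integers F)).
Variables (C : closedFieldType) (iota : {rmorphism k -> C}).

Local Notation GF := (local_points G).
Local Notation K := (integral_points G).
Local Notation Gk := (points G (alg_along red)).
Local Notation GC := (points G (alg_along (iota \o red))).

Definition reduction (h : K) : Gk := point_map (structure_map red) h.

Definition inflation (V : lmodType C) (rho : Gk -> {linear V -> V}) (h : K) :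
  {linear V -> V} := rho (reduction h).

Definition restriction (W : lmodType C) (sigma : GF -> {linear W -> W}) (h : K) :
  {linear W -> W} := sigma (int_to_local h).

Definition smooth_rep (W : lmodType C) (sigma : GF -> {linear W -> W}) : Prop :=
  is_rep sigma /\ forall w : W, open [set g | sigma g w = w].

(* The points of G(k) that lie in N over the algebraic closure. *)
Definition k_points (N : set GC) : set Gk :=
  [set g | N (point_map (along_map red iota) g)].

Section HeckeAlgebra.
Variables (V : lmodType C) (rho : Gk -> {linear V -> V}).

Definition hecke_support (f : GF -> {linear V -> V}) : set GF :=
  [set g | exists v, f g v <> 0].

Definition hecke_algebra : set (GF -> {linear V -> V}) := [set f |
  compact (closure (hecke_support f)) /\
  forall h1 g h2 v,
    f (int_to_local h1 * g * int_to_local h2)%g v =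
    inflation rho h1 (f g (inflation rho h2 v))].

(* The sum over gamma in G(F)/K of (f(gamma) (x) gamma) x, for x fixed by K; the
   representative of each coset is irrelevant for such x and f in the Hecke algebra. *)
Definition hecke_act (W : lmodType C) (sigma : GF -> {linear W -> W})
    (f : GF -> {linear V -> V}) (x : tensor V W) : tensor V W :=
  \sum_(c \in @left_K_cosets _ _ F G)
    tensor_map (f (xget 1%g c)) (sigma (xget 1%g c)) x.

(* f t is the composite V ->> V_N+ <~ V^N- >-> V: its value at v is the element
   of V^N- with the same image as v in V_N+. *)
Definition is_Tbar (t : GF) (Nplus Nminus : set Gk) (f : GF -> {linear V -> V}) : Prop :=
  [/\ hecke_algebra f, hecke_support f = K_double_coset t &
      forall v, fixed rho Nminus (f t v) /\
        to_coinv rho Nplus (f t v) = to_coinv rho Nplus v].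

(* The induction from the open subgroup K cap tKt^-1 of the compact group K of
   V^N-, on which the subgroup acts through rho; all such functions are locally
   constant. *)
Definition induced (t : GF) (Nminus : set Gk) : set (K -> V) := [set phi |
  (forall x, fixed rho Nminus (phi x)) /\
  (forall h x, K_cap_conj t h -> phi (h * x)%g = inflation rho h (phi x))].

Definition right_translation (h : K) (phi : K -> V) : K -> V := fun x => phi (x * h)%g.

Definition frob_unit (t : GF) (v : V) : K -> V :=
  fun x => if `[< K_cap_conj t x >] then inflation rho x v else 0.

(* The K-equivariant map Ind -> V adjoint to the inclusion of V^N- in V; frob_unit is
   the unit V^N- -> Ind of the adjunction. *)
Definition is_frobenius_map (t : GF) (Nminus : set Gk)
    (Phi : (K -> V) -> V) : Prop :=
  [/\ forall a phi psi, induced t Nminus phi -> induced t Nminus psi ->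
        Phi (a *: phi + psi) = a *: Phi phi + Phi psi,
      forall h phi, induced t Nminus phi ->
        Phi (right_translation h phi) = inflation rho h (Phi phi) &
      forall v, fixed rho Nminus v -> Phi (frob_unit t v) = v].
End HeckeAlgebra.
End Hecke.

(* Main.v *)
(* Let x in (V (x) pi)^K be nonzero with Tbar x = 0. With A : V -> Ind sending u to the image of
   Tbar(t) u in the induced module, the vector Y = sum_h (h A (x) h t) x over h in K / (K cap tKt^-1)
   of Ind (x) pi is K-fixed, and the Frobenius map sends it to Tbar x = 0.  Moreover Y <> 0:
   evaluating at 1 gives (Tbar(t) (x) t) x, and if that vanished then the left support of x, a nonzero
   K-stable subspace of V, would lie in the kernel of Tbar(t) <> 0; but V is irreducible under K because
   K -> G(k) is surjective (G is smooth and O_F is complete).  So the left support U of Y is a finitely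
   generated K-submodule of the kernel, and for a maximal proper K-submodule X of U the image of Y in
   (U / X) (x) pi is a nonzero K-fixed vector.

   The group K cap tKt^-1 has finite index in K because the support KtK of Tbar has compact closure and
   the cosets of K are open. *)
Require Import Defs.
From HB Require Import structures.
From mathcomp Require Import all_boot all_order all_algebra all_field.
From mathcomp Require Import boolp classical_sets functions fsbigop topology.
From mathcomp Require Import finmap cardinality freeg ring.

Set Implicit Arguments.
Unset Strict Implicit.
Unset Printing Implicit Defensive.

Import GRing.Theory.
Local Open Scope classical_set_scope.
Local Open Scope ring_scope.

(** * Submodules *)

(** No basis is at hand for the modules involved, and the group acts on both tensor factors at once.
    Tensors are therefore tested by contractions id (x) l, with l a linear functional on the right
    factor supplied by Zorn's lemma. A single contraction is not equivariant, but for fixed x the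
    set of all (id (x) l) x is a subrepresentation, since h merely changes l into l h^-1. This set
    is the left support.

    On the arithmetic side, O_F is given only as the integral closure of Z_p in F, and its
    uniformiser and residue field only through non-units. Formal smoothness lifts points along
    powers of the uniformiser, whereas limits are available along powers of p. The bridge is an
    integral equation of the uniformiser, which makes some power of it a multiple of p. As k is
    finite, O_F / p is then finite, and a series in powers of p with coefficients in O_F reduces to
    finitely many series in Z_p. *)

Section LinearOf.
Variables (R : pzRingType) (U V : lmodType R) (f : U -> V) (f_lin : linear f).
Definition linear_of (_ : linear f) : U -> V := f.
HB.instance Definition _ := GRing.isLinear.Build R U V _ (linear_of f_lin) f_lin.
End LinearOf.

Section Submodules.
Variables (C : fieldType) (M : lmodType C).
Implicit Types (X Z : set M).

Lemma submodD X x y : submod X -> X x -> X y -> X (x + y).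
Proof. by move=> sX Xx Xy; rewrite -[x]scale1r; exact: sX.2. Qed.

Lemma submodZ X a x : submod X -> X x -> X (a *: x).
Proof. by move=> sX Xx; rewrite -[a *: x]addr0; exact: sX.2 _ _ _ Xx sX.1. Qed.

Lemma submodB X x y : submod X -> X x -> X y -> X (x - y).
Proof. by move=> sX Xx Xy; rewrite -scaleN1r; apply: submodD => //; exact: submodZ. Qed.

Lemma submod_sum X (I : Type) (r : seq I) (P : pred I) (f : I -> M) :
  submod X -> (forall i, P i -> X (f i)) -> X (\sum_(i <- r | P i) f i).
Proof.
move=> sX Xf; elim/big_rec: _ => [|i y Pi Xy]; first exact: sX.1.
by apply: submodD => //; exact: Xf.
Qed.

Lemma lin_span_id X x : submod X -> (x \in lin_span X) <-> X x.
Proof.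
move=> sX; split=> [/asboolP|Xx]; first exact.
by apply/asboolP => Z _; apply.
Qed.

Lemma quot_proj_eq0 X x : submod X -> quot_proj X x = 0 <-> X x.
Proof.
move=> sX; rewrite -(lin_span_id _ sX) -[x in x \in _]subr0 -quot_projP.
by rewrite -[in X in _ <-> _ = X](subrr 0) quot_projB subrr.
Qed.

Lemma quot_proj_linear X : linear (quot_proj X : M -> quot_mod X).
Proof. by move=> a x y; rewrite quot_projD quot_projZ. Qed.
HB.instance Definition _ X :=
  GRing.isLinear.Build C M (quot_mod X) _ (quot_proj X) (quot_proj_linear X).

Definition stable (I : Type) (act : I -> M -> M) X : Prop :=
  forall i x, X x -> X (act i x).

(** Zorn: as [s] is finite, the union of a chain of submodules that do not contain [s] does not
    contain it either. Without operators and for a single vector this gives hyperplanes; with a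
    group acting and [s] generating, maximal proper subrepresentations. *)
Lemma max_stable_submod (I : Type) (act : I -> M -> M) (s : seq M) X :
    submod X -> stable act X -> ~ {in s, forall x, X x} ->
  exists Y, [/\ submod Y, stable act Y, X `<=` Y, ~ {in s, forall x, Y x} &
    forall Z, submod Z -> stable act Z -> Y `<=` Z ->
      Z `<=` Y \/ {in s, forall x, Z x}].
Proof.
move=> sX stX Xs.
pose good Y := [/\ submod Y, stable act Y, X `<=` Y & ~ {in s, forall x, Y x}].
pose P : set (set M) := [set Y | Y = set0 \/ good Y].
have [F FP tot|Y [PY maxY]] := @Zorn_bigcup _ P.
  have [F0|] := pselect (forall A, F A -> A = set0).
    by left; apply/seteqP; split=> // x [A /F0 ->].
  move=> /existsNP[A0] /not_implyP[FA0 A0n].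
  have goodF A x : F A -> A x -> good A by move=> FA Ax; case: (FP A FA) => // Ae; rewrite Ae in Ax.
  have gA0 : good A0 by case: (FP A0 FA0).
  right; split.
  - split=> [|a u v [A FA Au] [B FB Bv]]; first by exists A0 => //; case: gA0 => -[].
    have [/(_ u Au) Bu|/(_ v Bv) Av] := tot A B FA FB.
      by exists B => //; case: (goodF B v FB Bv) => sB _ _ _; exact: sB.2.
    by exists A => //; case: (goodF A u FA Au) => sA _ _ _; exact: sA.2.
  - by move=> i x [A FA Ax]; exists A => //; case: (goodF A x FA Ax) => _ st _ _; exact: st.
  - by move=> x Xx; exists A0 => //; case: gA0 => _ _ XA _; exact: XA.
  (* Each element of [s] lies in some member of the chain; the largest of these finitely many
     members contains all of [s]. *)
  - move=> sF; have [A FA sA] : exists2 A, F A & {in s, forall x, A x}.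
      move: sF; clear Xs goodF gA0 A0n X stX sX P FP good; move: A0 FA0; elim: s => [|y s IH] A0 FA0 sF.
        by exists A0.
      have [|A FA sA] := IH A0 FA0; first by move=> x xs; apply: sF; rewrite inE xs orbT.
      have [|B FB By] := sF y; first by rewrite inE eqxx.
      have [AB|BA] := tot A B FA FB.
        exists B => // x; rewrite inE => /predU1P[->//|xs]; exact/AB/sA.
      exists A => // x; rewrite inE => /predU1P[->|xs]; [exact: BA|exact: sA].
    case: (FP A FA) => [Ae|[_ _ _ nA]]; last exact: nA.
    case: gA0 => _ _ _ nA; apply: nA => x xs; have := sA x xs.
    by rewrite Ae.
have gX : good X by split.
have gY : good Y.
  case: PY => // Y0; have XP : P X by right.
  exfalso; apply: (maxY X) => //; rewrite Y0; split=> // /(_ 0 sX.1); exact.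
case: gY => sY stY XY Ys; exists Y; split=> // Z sZ stZ YZ.
apply: contrapT => /not_orP[ZY Zs].
apply: (maxY Z); first by split.
by right; split=> //; apply: subset_trans XY YZ.
Qed.

(** A submodule [Y] maximal among those containing [X] and missing [v] is a complement of the line
    of [v]; [l] is the coordinate along [v]. *)
Lemma separating_functional X v : submod X -> ~ X v ->
  exists l : {linear M -> C^o}, l v = 1 /\ forall x, X x -> l x = 0.
Proof.
move=> sX Xv.
have [||Y [sY _ XY Yv maxY]] := @max_stable_submod void (fun _ => id) [:: v] X sX; first by case.
  by move=> /(_ v); rewrite inE eqxx => h; apply/Xv/h.
have {}Yv : ~ Y v by move=> Yv'; apply: Yv => x; rewrite inE => /eqP ->.
have dec u : exists a : C, Y (u - a *: v).
  have [Yu|Yu] := pselect (Y u); first by exists 0; rewrite scale0r subr0.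
  (* [Z] is Y + C u, strictly larger than [Y], so it contains [v]. *)
  pose Z := [set x | exists a : C, Y (x - a *: u)].
  have [|||/(_ u) h|/(_ v)] := maxY Z.
  - split=> [|a x y [b Yx] [c Yy]]; first by exists 0; rewrite scale0r subr0; exact: sY.1.
    exists (a * b + c); rewrite scalerDl -scalerA opprD addrACA -scalerBr.
    exact: sY.2.
  - by case.
  - by move=> x Yx; exists 0; rewrite scale0r subr0.
  - by exfalso; apply/Yu/h; exists 1; rewrite scale1r subrr; exact: sY.1.
  rewrite inE eqxx => /(_ isT)[a Yva].
  have a0 : a != 0 by apply/eqP => a0; apply: Yv; move: Yva; rewrite a0 scale0r subr0.
  exists a^-1; have -> : u - a^-1 *: v = - a^-1 *: (v - a *: u).
    by rewrite scalerBr scalerA mulNr mulVf // scaleN1r opprK addrC scaleNr.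
  exact: submodZ.
have uniq a b u : Y (u - a *: v) -> Y (u - b *: v) -> a = b.
  move=> Ya Yb; apply/eqP; rewrite -subr_eq0; apply/negP => /negP ab.
  apply: Yv; have -> : v = (a - b)^-1 *: ((u - b *: v) - (u - a *: v)).
    by rewrite [X in _ *: X]addrC opprB addrA subrK -scalerBl scalerA mulVf // scale1r.
  by apply: submodZ => //; exact: submodB.
pose f u : C^o := projT1 (cid (dec u)).
have fP u : Y (u - f u *: v) := projT2 (cid (dec u)).
have f_lin : linear f.
  move=> a x y; apply: (uniq _ _ (a *: x + y)) => //.
  rewrite scalerDl -scalerA opprD addrACA -scalerBr; exact: sY.2.
exists (linear_of f_lin); split=> [|x Xx]; rewrite /linear_of.
  by apply: (uniq _ _ v) => //; rewrite scale1r subrr; exact: sY.1.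
by apply: (uniq _ _ x) => //; rewrite scale0r subr0; exact: XY.
Qed.

Variable X : set M.
Hypothesis sX : submod X.

Definition submod_pred of submod X : {pred M} := fun x => `[< X x >].
Fact submod_pred_closed : submod_closed (submod_pred sX).
Proof.
split=> [|a u v /asboolP Xu /asboolP Xv]; apply/asboolP; first exact: sX.1.
exact: sX.2.
Qed.
HB.instance Definition _ := GRing.isSubmodClosed.Build C M (submod_pred sX) submod_pred_closed.

Definition submod_type := {x : M | x \in submod_pred sX}.
HB.instance Definition _ := [isSub of submod_type for sval].
HB.instance Definition _ := [Choice of submod_type by <:].
HB.instance Definition _ := [SubChoice_isSubZmodule of submod_type by <:].
HB.instance Definition _ := [SubZmodule_isSubLmodule of submod_type by <:].

Lemma submod_typeP (x : submod_type) : X (val x).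
Proof. by have /asboolP := valP x. Qed.

End Submodules.

(** * Tensor products and their fixed vectors *)

Section Contraction.
Variable C : fieldType.

HB.instance Definition _ (V W V' W' : lmodType C) (f : {linear V -> V'})
    (g : {linear W -> W'}) :=
  GRing.isLinear.Build C (tensor V W) (tensor V' W') _ (tensor_map f g)
    (tensor_map_linear f g).

Lemma tens0l (V W : lmodType C) (w : W) : tens (0 : V) w = 0.
Proof. by rewrite -(scale0r 0) tensZl scale0r. Qed.
Lemma tens0r (V W : lmodType C) (v : V) : tens v (0 : W) = 0.
Proof. by rewrite -(scale0r 0) tensZr scale0r. Qed.

Lemma tensor_map_comp (V W V' W' V2 W2 : lmodType C) (f : {linear V -> V'})
    (g : {linear W -> W'}) (f' : {linear V' -> V2}) (g' : {linear W' -> W2}) x :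
  tensor_map f' g' (tensor_map f g x) = tensor_map (f' \o f) (g' \o g) x.
Proof.
elim/tensor_ind: x => [|v w x IH]; first by rewrite !linear0.
by rewrite !linearD /= IH !tensor_mapE.
Qed.

Lemma eq_tensor_map (V W V' W' : lmodType C) (f f' : {linear V -> V'})
    (g g' : {linear W -> W'}) x :
  f =1 f' -> g =1 g' -> tensor_map f g x = tensor_map f' g' x.
Proof.
move=> ff gg; elim/tensor_ind: x => [|v w x IH]; first by rewrite !linear0.
by rewrite !linearD /= IH !tensor_mapE ff gg.
Qed.

Section Contr.
Variables (V W : lmodType C) (l : {linear W -> C^o}).
Let h (vw : V * W) := (l vw.2 : C) *: vw.1.

Let lift_eq D E : quot_proj (tensor_rel (W:=W)) D = quot_proj (tensor_rel (W:=W)) E ->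
  fglift h D = fglift h E.
Proof.
have lB := @lift_is_additive C _ _ h.
have l0 : fglift h 0 = 0 by have := lB 0 0; rewrite !subrr.
move=> /quot_projP /asboolP DE; apply/eqP; rewrite -subr_eq0 -lB.
apply/eqP; apply: (DE [set x | fglift h x = 0]) => [|r].
  split=> [|a u v /= hu hv]; first exact: l0.
  by rewrite fgliftZD hu hv scaler0 addr0.
have lZ a D' : fglift h (a *: D') = a *: fglift h D'.
  by have := fgliftZD h a D' 0; rewrite !addr0 => ->; rewrite l0 addr0.
have h1 vw : fglift h << vw >> = h vw by rewrite liftU scale1r.
case=> [[v [v' [w ->]]]|[v [w [w' ->]]]|[a [v [w ->]]]|[a [v [w ->]]]] /=.
- by rewrite !lB !h1 /h /= scalerDr addrAC addrK subrr.
- by rewrite !lB !h1 /h /= linearD scalerDl addrAC addrK subrr.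
- by rewrite lB lZ !h1 /h /= !scalerA mulrC subrr.
- by rewrite lB lZ !h1 /h /= linearZ scalerA subrr.
Qed.

(* The map id (x) l, with V (x) C identified with V. *)
Definition contract (x : tensor V W) : V := fglift h (quot_repr x).

Lemma contractE v w : contract (tens v w) = (l w : C) *: v.
Proof. by rewrite /contract (@lift_eq _ << (v, w) >>) ?quot_reprK // liftU scale1r. Qed.

Fact contract_linear : linear contract.
Proof.
move=> a x y; rewrite /contract -fgliftZD; apply: lift_eq.
by rewrite quot_reprK quot_projD quot_projZ !quot_reprK.
Qed.
HB.instance Definition _ :=
  GRing.isLinear.Build C (tensor V W) V _ contract contract_linear.
End Contr.

Lemma contract_map (V W V' W' : lmodType C) (f : {linear V -> V'})
    (g : {linear W -> W'}) (l : {linear W' -> C^o}) x :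
  contract l (tensor_map f g x) = f (contract (l \o g) x).
Proof.
elim/tensor_ind: x => [|v w x IH]; first by rewrite !linear0.
by rewrite !linearD /= IH tensor_mapE !contractE linearZ.
Qed.

Lemma contract_map_id (V W V' : lmodType C) (f : {linear V -> V'})
    (l : {linear W -> C^o}) x : contract l (tensor_map f idfun x) = f (contract l x).
Proof.
exact: contract_map.
Qed.

Section Support.
Variables (V W : lmodType C).
Implicit Types (s : seq (V * W)) (x : tensor V W).

Definition tens_sum s : tensor V W := \sum_(vw <- s) tens vw.1 vw.2.

Lemma tens_sum_exists x : exists s, x = tens_sum s.
Proof.
elim/tensor_ind: x => [|v w x [s ->]]; first by exists [::]; rewrite /tens_sum big_nil.
by exists ((v, w) :: s); rewrite /tens_sum big_cons.
Qed.

(** The linear span, by recursion so that membership hands over one coefficient at a time. *)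
Fixpoint combination (s : seq W) : set W :=
  if s is w :: s' then [set x | exists a, combination s' (x - a *: w)] else [set 0].

Lemma combination_submod (s : seq W) : submod (combination s).
Proof.
elim: s => [|w s IH]; first by split=> // a u v /= -> ->; rewrite scaler0 addr0.
split=> [|a u v [b hu] [c hv]]; first by exists 0; rewrite scale0r subr0; exact: IH.1.
by exists (a * b + c); rewrite scalerDl -scalerA opprD addrACA -scalerBr; exact: IH.2.
Qed.

Lemma combination_mem (s : seq W) w : w \in s -> combination s w.
Proof.
elim: s => //= w' s IH; rewrite inE => /predU1P[->|/IH ws].
  by exists 1; rewrite scale1r subrr; exact: (combination_submod s).1.
by exists 0; rewrite scale0r subr0.
Qed.

(** If w = sum a_i w_i, adding a_i v to the left factor of each w_i absorbs v (x) w without a new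
    term. *)
Lemma tens_absorb s v w : combination [seq vw.2 | vw <- s] w ->
  exists2 s', size s' = size s & tens v w + tens_sum s = tens_sum s'.
Proof.
elim: s w => [w ->|[v1 w1] s IH w [a /IH[s' ss' eq']]].
  by exists [::]; rewrite // tens0r add0r.
exists ((v1 + a *: v, w1) :: s'); first by rewrite /= ss'.
rewrite /tens_sum !big_cons /= -/(tens_sum s') -eq' addrA [in RHS]addrA -/(tens_sum s).
congr (_ + _); rewrite tensDl tensZl -tensZr -addrA -tensDr addrCA subrr addr0.
by rewrite addrC.
Qed.

(* In a representation of x with the least number of terms the right factors
   are independent, so the left factors are values of contractions. *)
Lemma contract_submod (X : set V) x : submod X ->
  (forall l : {linear W -> C^o}, X (contract l x)) ->
  exists2 s, x = tens_sum s & forall vw, vw \in s -> X vw.1.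
Proof.
move=> sX; have [s ->] := tens_sum_exists x.
move: {2}(size s) (leqnn (size s)) => n; elim: n s => [|n IH] s.
  by rewrite leqn0 size_eq0 => /eqP -> _; exists [::].
case: s => [_ _|[v w] s]; first by exists [::].
rewrite ltnS /= => sn Xs; rewrite /tens_sum big_cons /= -/(tens_sum s).
have [/tens_absorb-/(_ v)[s' ss' eqs]|nw] := pselect (combination [seq vw.2 | vw <- s] w).
  rewrite eqs; apply: IH; first by rewrite ss'.
  by move=> l; rewrite -eqs; have := Xs l; rewrite /tens_sum big_cons.
(* Here [w] is independent of the other right factors, so some [l] isolates it and the contraction
   by [l] is [v] itself. *)
have [l [lw ls]] := separating_functional (combination_submod _) nw.
have Xv : X v.
  have := Xs l; rewrite linear_sum big_cons /= contractE lw scale1r big_seq big1 ?addr0 //.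
  move=> [v' w'] vws; rewrite /= contractE ls ?scale0r //.
  by apply: combination_mem; apply/mapP; exists (v', w').
have [||s' -> Xs'] := IH s => //.
  move=> l'; have := Xs l'; rewrite /tens_sum big_cons linearD /= contractE => h.
  rewrite -[contract _ _](addrK ((l' w : C) *: v)) addrC -scaleN1r.
  by apply: sX.2 => //; [exact: submodZ|rewrite addrC].
exists ((v, w) :: s'); first by rewrite /tens_sum big_cons.
by move=> vw; rewrite inE => /predU1P[->|/Xs'].
Qed.

(** The case X = 0 of [contract_submod]: contractions separate tensors, so identities in V (x) W can
    be checked in V. *)
Lemma contract_eq0 x : (forall l : {linear W -> C^o}, contract l x = 0) -> x = 0.
Proof.
move=> x0; have [||s -> s0] := @contract_submod [set 0] x.
- by split=> // a u v -> ->; rewrite scaler0 addr0.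
- exact: x0.
- by rewrite /tens_sum big_seq big1 // => vw /s0 ->; rewrite tens0l.
Qed.

End Support.

End Contraction.

(** * Left supports of fixed tensors and irreducible constituents *)

Section FixedTensors.
Variables (C : fieldType) (H : groupType).

(** The left support: the least submodule X of V such that x is a sum of tensors v (x) w with v in
    X. *)
Definition supported (V W : lmodType C) (x : tensor V W) : set V :=
  [set v | exists l : {linear W -> C^o}, v = contract l x].

Lemma supported_submod (V W : lmodType C) (x : tensor V W) : submod (supported x).
Proof.
have lin a (l1 l2 : {linear W -> C^o}) : linear (fun w => a *: l1 w + l2 w : C^o).
  move=> b u v; rewrite (linearP l1) (linearP l2).
  rewrite -[LHS]/(a * (b * (l1 u : C) + l1 v) + (b * (l2 u : C) + l2 v)).
  rewrite -[RHS]/(b * (a * (l1 u : C) + l2 u) + (a * (l1 v : C) + l2 v)).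
  by rewrite !mulrDr !mulrA (mulrC b a) addrACA.
have E a (l1 l2 : {linear W -> C^o}) :
    contract (linear_of (lin a l1 l2)) x = a *: contract l1 x + contract l2 x.
  elim/tensor_ind: x => [|v w x IH]; first by rewrite !linear0 ?scaler0 addr0.
  rewrite !linearD /= IH !contractE /linear_of addrACA.
  rewrite -[X in X *: v + _]/(a * (l1 w : C) + (l2 w : C)).
  by rewrite scalerDl -scalerA.
split=> [|a u v [l1 ->] [l2 ->]]; last by exists (linear_of (lin a l1 l2)).
have l0 : linear (fun _ : W => 0 : C^o) by move=> a u v; rewrite scaler0 addr0.
exists (linear_of l0); elim/tensor_ind: x {E} => [|v w x IH]; first by rewrite linear0.
by rewrite linearD /= -IH contractE /linear_of scale0r addr0.
Qed.

(** Writing x as h^-1 x shows that h maps the contraction of x by l to its contraction by l h^-1. *)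
Lemma supported_stable (V W : lmodType C) (rho : H -> {linear V -> V})
    (sigma : H -> {linear W -> W}) x :
  is_rep rho -> tensor_fixed rho sigma x ->
  stable (fun h => rho h : V -> V) (supported x).
Proof.
move=> [rho1 rhoM] fx h _ [l ->]; exists (l \o sigma h^-1%g).
by rewrite -{1}[x](fx h^-1%g) contract_map -rhoM mulgV rho1.
Qed.

Lemma tensor_map_eq0_irreducible (V W : lmodType C) (rho : H -> {linear V -> V})
    (sigma : H -> {linear W -> W}) (T : {linear V -> V}) x :
  irreducible_rep rho -> tensor_fixed rho sigma x -> (exists v, T v <> 0) ->
  tensor_map T idfun x = 0 -> x = 0.
Proof.
move=> [rrho [_ irr]] fx [v Tv] Tx.
have [S0|ST] := irr _ (supported_submod x) (fun h v => @supported_stable _ _ _ _ _ rrho fx h v).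
  apply: contract_eq0 => l; have : supported x (contract l x) by exists l.
  by rewrite S0.
exfalso; apply: Tv; have [l ->] : supported x v by rewrite ST.
by rewrite -contract_map_id Tx linear0.
Qed.

Section QuotientRep.
Variables (U : lmodType C) (rho : H -> {linear U -> U}) (X : set U).
Hypotheses (sX : submod X) (stX : stable (fun h => rho h : U -> U) X).

Definition quot_act (h : H) (z : quot_mod X) : quot_mod X :=
  quot_proj X (rho h (quot_repr z)).

Lemma quot_actE h u : quot_act h (quot_proj X u) = quot_proj X (rho h u).
Proof.
apply/eqP; rewrite -subr_eq0 -quot_projB; apply/eqP/quot_proj_eq0 => //.
rewrite -linearB; apply: stX; apply/(quot_proj_eq0 _ sX).
by rewrite quot_projB quot_reprK subrr.
Qed.

Fact quot_act_linear h : linear (quot_act h).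
Proof.
move=> a x y; rewrite -[x]quot_reprK -[y]quot_reprK -linearP !quot_actE -linearP.
by congr quot_proj; rewrite linearP.
Qed.
Definition quot_rep h : {linear quot_mod X -> quot_mod X} := linear_of (quot_act_linear h).

Lemma quot_repE h u : quot_rep h (quot_proj X u) = quot_proj X (rho h u).
Proof. exact: quot_actE. Qed.

Lemma quot_is_rep : is_rep rho -> is_rep quot_rep.
Proof.
move=> [rho1 rhoM]; split=> [v|g h v]; rewrite -[v]quot_reprK.
  by rewrite quot_repE rho1.
by rewrite !quot_repE rhoM !quot_reprK.
Qed.
End QuotientRep.

Section RestrictedRep.
Variables (M : lmodType C) (act : H -> {linear M -> M}) (X : set M).
Hypotheses (sX : submod X) (stX : stable (fun h => act h : M -> M) X).

Fact sub_act_subproof h (x : submod_type sX) : act h (val x) \in submod_pred sX.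
Proof. by apply/asboolP; apply: stX; exact: submod_typeP. Qed.
Definition sub_act h (x : submod_type sX) : submod_type sX := Sub (act h (val x)) (sub_act_subproof h x).
Fact sub_act_linear h : linear (sub_act h).
Proof. by move=> a x y; apply: val_inj; rewrite /= !linearP. Qed.
Definition sub_rep h : {linear submod_type sX -> submod_type sX} :=
  linear_of (sub_act_linear h).

Lemma sub_is_rep : is_rep act -> is_rep sub_rep.
Proof.
move=> [act1 actM]; split=> [v|g h v]; apply: val_inj; rewrite /= ?act1 //.
Qed.
End RestrictedRep.

Section InvariantsOfConstituents.
Variables (W : lmodType C) (sigma : H -> {linear W -> W}).

(** The left factors of a finite expression of Y generate its support U, so a stable submodule X
    maximal among those missing one of them is a maximal proper subrepresentation. If Y died in (U /
    X) (x) W, all its contractions would lie in X. *)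
Lemma fixed_irreducible_quotient (U : lmodType C) (rho : H -> {linear U -> U})
    (Y : tensor U W) :
    is_rep rho -> tensor_fixed rho sigma Y -> Y <> 0 -> supported Y = setT ->
  exists (V' : lmodType C) (rho' : H -> {linear V' -> V'}) (q : {linear U -> V'}),
    [/\ irreducible_rep rho', forall h u, q (rho h u) = rho' h (q u),
        forall v, exists u, q u = v &
        tensor_fixed rho' sigma (tensor_map q idfun Y) /\ tensor_map q idfun Y <> 0].
Proof.
move=> rrho fY Y0 YT; have [s Ys] := tens_sum_exists Y.
have s_full (X : set U) : submod X -> {in [seq vw.1 | vw <- s], forall x, X x} -> X = setT.
  move=> sX Xs; apply/seteqP; split=> // u _.
  have [l ->] : supported Y u by rewrite YT.
  rewrite Ys linear_sum big_seq; apply: submod_sum => // vw vws /=.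
  rewrite contractE; apply: submodZ => //; apply: Xs.
  by apply/mapP; exists vw.
have s0 : submod [set 0 : U] by split=> // a u v -> ->; rewrite scaler0 addr0.
have [|||X [sX stX _ Xs maxX]] :=
    @max_stable_submod _ U H (fun h => rho h) [seq vw.1 | vw <- s] [set 0].
- exact: s0.
- by move=> h x ->; exact: linear0.
- move=> /(s_full _ s0) T0; apply: Y0; apply: contract_eq0 => l.
  by have : [set 0 : U] (contract l Y) by rewrite T0.
have nX : X <> setT by move=> XT; apply: Xs => x _; rewrite XT.
pose q : {linear U -> quot_mod X} := quot_proj X.
exists (quot_mod X), (quot_rep sX stX), q; split.
- split; first exact: quot_is_rep.
  split.
    have [u Xu] : exists u, ~ X u.
      by apply/existsNP => XT; apply: nX; apply/seteqP; split.
    by exists (q u) => /(quot_proj_eq0 _ sX).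
  move=> Z sZ stZ; pose Z' := [set u | Z (q u)].
  have sZ' : submod Z'.
    by split=> [|a u v Zu Zv]; rewrite /Z' /= ?linear0 ?linearP; [exact: sZ.1|exact: sZ.2].
  have [| |ZX|/(s_full _ sZ') ZT] := maxX Z' sZ'.
  - by move=> h u /(stZ h); rewrite /Z' /= quot_repE.
  - by move=> u /(quot_proj_eq0 _ sX) qu; rewrite /Z' /= [q u]qu; exact: sZ.1.
  - left; apply/seteqP; split=> z /=; last by move=> ->; exact: sZ.1.
    rewrite -[z]quot_reprK => /ZX /(quot_proj_eq0 _ sX); exact.
  - right; apply/seteqP; split=> // z _.
    have : Z' (quot_repr z) by rewrite ZT.
    by rewrite /Z' /= [q _]quot_reprK.
- by move=> h u; rewrite quot_repE.
- by move=> v; exists (quot_repr v); exact: quot_reprK.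
split.
  move=> h; rewrite -[in RHS](fY h) !tensor_map_comp; apply: eq_tensor_map => // u /=.
  by rewrite quot_repE.
move=> qY; apply: nX; apply/seteqP; split=> // u _.
have [l ->] : supported Y u by rewrite YT.
apply/(quot_proj_eq0 _ sX); rewrite -[quot_proj _ _]/(q _) -contract_map_id qY.
exact: linear0.
Qed.

(** Y is rewritten with left factors in its support U, which gives a tensor [Y'] over U. That [Y']
    is again fixed is checked on contractions, where only the injectivity of U -> M is used. *)
Lemma fixed_irreducible_constituent (M : lmodType C) (act : H -> {linear M -> M})
    (M0 : set M) (Y : tensor M W) :
    is_rep act -> tensor_fixed act sigma Y -> Y <> 0 -> supported Y `<=` M0 ->
  exists (V' : lmodType C) (rho' : H -> {linear V' -> V'}),
    irreducible_constituent (fun h => act h : M -> M) M0 rho' /\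
    exists x : tensor V' W, tensor_fixed rho' sigma x /\ x <> 0.
Proof.
move=> ract fY Y0 YM0.
pose sX := supported_submod Y; pose stX := supported_stable ract fY.
have [s Ys Xs] := contract_submod sX (fun l => ex_intro _ l erefl).
pose U := submod_type sX; pose i : {linear U -> M} := val.
have iE u : i u = val u by [].
clearbody i.
(* A retraction of M onto U, 0 off the support; it extends the quotient map of U to the map on M
   that a constituent asks for. *)
pose r (m : M) : U := insubd 0 m.
have rK m : supported Y m -> i (r m) = m.
  by move=> Ym; rewrite iE; apply: insubdK; apply/asboolP.
clearbody r.
pose Y' : tensor U W := \sum_(vw <- s) tens (r vw.1) vw.2.
have iY' : tensor_map i idfun Y' = Y.
  apply: etrans (esym Ys); rewrite linear_sum; apply: eq_big_seq => vw vws.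
  by apply: etrans (tensor_mapE i idfun _ _) _; rewrite rK //; exact: Xs.
have i_inj : injective i by move=> u v; rewrite !iE; exact: val_inj.
have cY' l : i (contract l Y') = contract l Y by rewrite -contract_map_id iY'.
have fY' : tensor_fixed (sub_rep sX stX) sigma Y'.
  move=> h; apply/eqP; rewrite -subr_eq0; apply/eqP/contract_eq0 => l.
  apply: i_inj; rewrite linear0 !linearB cY' -[in RHS](subrr (contract l Y)).
  congr (_ - _); rewrite -contract_map_id; congr contract.
  transitivity (tensor_map (act h) (sigma h) (tensor_map i idfun Y')).
    by rewrite !tensor_map_comp; apply: eq_tensor_map => // u; rewrite /= !iE.
  by rewrite iY' fY.
have Y'0 : Y' <> 0 by move=> Y'0; apply: Y0; rewrite -iY' Y'0 linear0.
have Y'T : supported Y' = setT.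
  apply/seteqP; split=> // u _; have [l ul] := submod_typeP u.
  by exists l; apply: i_inj; rewrite cY' -ul iE.
have [V' [rho' [q [irr eqv surj [fq q0]]]]] :=
  fixed_irreducible_quotient (sub_is_rep sX stX ract) fY' Y'0 Y'T.
exists V', rho'; split; last by exists (tensor_map q idfun Y').
have rE (u : U) : r (i u) = u by apply: i_inj; rewrite rK // iE; exact: submod_typeP.
split=> //; exists (supported Y), (q \o r); split.
- by split.
- exact: stX.
- move=> a x y Xx Xy /=; rewrite -linearP; congr (q _); apply: i_inj.
  by rewrite linearP !rK //; exact: sX.2.
- move=> h x Xx /=; rewrite -eqv; congr (q _); apply: i_inj.
  rewrite rK; last exact: (stX h).
  by rewrite iE /= -iE rK.
- move=> v; have [u <-] := surj v; exists (i u); first by rewrite iE; exact: submod_typeP.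
  by rewrite /= rE.
Qed.
End InvariantsOfConstituents.
End FixedTensors.

(** * The ring of integers *)

Section PadicIntegerLemmas.
Variables (p : nat) (p_pr : prime p).
Local Notation Zp := (Zp_of p_pr).
Implicit Types x y : Zp.

Definition res x n : 'Z_(p ^ n.+1) := residue x n.

Lemma resD x y n : res (x + y) n = res x n + res y n. Proof. by []. Qed.
Lemma resM x y n : res (x * y) n = res x n * res y n. Proof. by []. Qed.
Lemma res1 n : res 1 n = 1. Proof. by []. Qed.
Lemma res_nat m n : res m%:R n = m%:R.
Proof. by elim: m => [//|m IH]; rewrite -natr1 resD IH natr1. Qed.
Lemma res_inj x y : (forall n, res x n = res y n) -> x = y.
Proof. exact: padic_intP. Qed.

Lemma pX_gt1 n : (1 < p ^ n.+1)%N.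
Proof. by rewrite -[1%N](expn0 p) ltn_exp2l ?prime_gt1. Qed.

Lemma eq_natZp n a b : a%:R = b%:R :> 'Z_(p ^ n.+1) <-> a = b %[mod p ^ n.+1].
Proof.
split=> [/(congr1 val)|ab]; first by rewrite /= !val_Zp_nat ?pX_gt1.
by apply: val_inj; rewrite /= !val_Zp_nat ?pX_gt1.
Qed.

Lemma natr_res x n : (val (res x n))%:R = res x n.
Proof. exact: natr_Zp. Qed.

Lemma res_compat x n : val (res x n.+1) = val (res x n) %[mod p ^ n.+1].
Proof. by apply/eq_natZp; rewrite natr_res /res [RHS]residue_compat. Qed.

Lemma padic_of_seq (a : nat -> nat) : (forall n, a n.+1 = a n %[mod p ^ n.+1]) ->
  exists x, forall n, res x n = (a n)%:R.
Proof.
move=> ha; unshelve eexists.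
  exists (fun n => (a n)%:R) => n; apply/eq_natZp.
  by rewrite [val _]val_Zp_nat ?pX_gt1 // modn_dvdm ?dvdn_exp2l // ha.
by [].
Qed.

Lemma res0_dvd x n : res x 0 = 0 -> (p %| val (res x n))%N.
Proof.
move=> x0; elim: n => [|n IH]; first by rewrite x0.
have := res_compat x n; rewrite /dvdn.
move=> /(congr1 (fun m => m %% p)%N); rewrite !modn_dvdm ?dvdn_exp //.
by move=> ->.
Qed.

Lemma padic_dvdp x : res x 0 = 0 -> exists y, x = p%:R * y.
Proof.
move=> x0; have p0 := prime_gt0 p_pr.
(* Division by p costs one digit of precision, so level n of the quotient is read off level n.+1 of
   x. *)
have [|y yE] := @padic_of_seq (fun n => val (res x n.+1) %/ p)%N.
  move=> n; have := res_compat x n.+1.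
  have /dvdnP[a ->] := res0_dvd n.+2 x0; have /dvdnP[b ->] := res0_dvd n.+1 x0.
  rewrite !mulnK // expnS mulnC [(b * p)%N]mulnC -!muln_modr.
  by move=> /eqP; rewrite eqn_pmul2l // => /eqP.
exists y; apply: res_inj => n; rewrite resM res_nat yE -natrM mulnC.
by rewrite divnK ?res0_dvd // -[LHS]natr_res; apply/eq_natZp; rewrite res_compat.
Qed.

(** Induction on a level at which x does not vanish: division by p lowers it by one. *)
Lemma padic_neq0 x : x <> 0 ->
  exists m y, x = p%:R ^+ m * y /\ res y 0 <> 0.
Proof.
move=> x0; have [n] : exists n, res x n <> 0.
  by apply/existsNP => xn; apply: x0; apply: res_inj => n; rewrite xn.
elim: n x {x0} => [|n IH] x xn; first by exists 0%N, x; rewrite expr0 mul1r.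
have [/padic_dvdp[y xy]|x0] := pselect (res x 0 = 0); last first.
  by exists 0%N, x; rewrite expr0 mul1r.
have [|m [z [yz z0]]] := IH y; last by exists m.+1, z; rewrite xy yz exprS mulrA.
move=> yn; apply: xn; rewrite xy resM res_nat -[res y _]natr_res -natrM.
rewrite -[0]/(0%:R); apply/eq_natZp; rewrite mod0n; apply/eqP.
rewrite -/(dvdn _ _); move: (res_compat y n); rewrite yn mod0n => /eqP.
move: (val (res y n.+1)) => b pb.
by rewrite expnS dvdn_pmul2l ?prime_gt0.
Qed.

(** Every residue of x is prime to p, hence a unit; the inverses at successive levels are compatible
    because inverses are unique. *)
Lemma padic_inv_exists x :  res x 0 <> 0 -> exists y, x * y = 1.
Proof.
move=> x0; have u n : res x n \is a GRing.unit.
  rewrite -natr_res unitZpE ?pX_gt1 //; apply: coprimeXl; rewrite prime_coprime //.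
  apply/negP => xn; apply: x0; rewrite -natr_res -[0]/(0%:R); apply/(eq_natZp).
  have : val (res x n) = val (res x 0) %[mod p].
    elim: n {xn} => [//|n IH]; rewrite -IH.
    have := congr1 (modn^~ p) (res_compat x n).
    by rewrite !modn_dvdm ?dvdn_exp.
  rewrite (eqP xn) mod0n => x00; apply: etrans (esym x00).
  by congr (_ %% _)%N; exact: expn1.
pose a n := val ((res x n)^-1).
have xa n : (a n * val (res x n))%:R = 1 :> 'Z_(p ^ n.+1).
  rewrite natrM natr_res natr_Zp; exact: mulVr (u n).
have [m|y yE] := @padic_of_seq a.
  apply/(eq_natZp); rewrite [RHS]natr_Zp; apply: (mulIr (u m)); rewrite (mulVr (u m)).
  rewrite -[X in _ * X]natr_res -natrM -[1]/(1%:R); apply/(eq_natZp).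
  rewrite -modnMmr -res_compat modnMmr.
  have := congr1 (modn^~ (p ^ m.+1)%N) ((eq_natZp _ _ 1).1 (xa m.+1)).
  by rewrite !modn_dvdm ?dvdn_exp2l.
by exists y; apply: res_inj => n; rewrite resM yE natr_Zp; exact: divrr (u n).
Qed.

Lemma padic_1_neq_pM x : 1 <> p%:R * x.
Proof.
move=> /(congr1 (res ^~ 0%N)); rewrite resM res_nat res1.
have -> : p%:R = 0 :> 'Z_(p ^ 1).
  by rewrite -[0]/(0%:R); apply/eq_natZp; rewrite expn1 modnn mod0n.
by rewrite mul0r => /eqP; rewrite oner_eq0.
Qed.

Lemma padic_p_neq0 : (p%:R : Zp) != 0.
Proof.
apply/eqP => /(congr1 (res ^~ 1%N)); rewrite res_nat.
rewrite -[res 0 1]/(0%:R) => /eq_natZp; rewrite mod0n modn_small.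
  by move=> p0; have := prime_gt0 p_pr; rewrite p0.
by rewrite -[X in (X < _)%N]expn1 ltn_exp2l // prime_gt1.
Qed.

(* z n = d n + d (n + 1) p + d (n + 2) p ^ 2 + ... *)
Lemma padic_digits (d : nat -> nat) :
  exists z : nat -> Zp, forall n, z n = (d n)%:R + p%:R * z n.+1.
Proof.
pose a N n := (\sum_(i < n.+1) d (N + i) * p ^ i)%N.
have aP N n : a N n.+1 = a N n %[mod p ^ n.+1].
  by rewrite /a big_ord_recr /= -modnDmr modnMl addn0.
exists (fun N => projT1 (cid (padic_of_seq (aP N)))) => N.
apply: res_inj => n; rewrite resD resM !res_nat.
case: cid => x /= ->; case: cid => y /= ->.
rewrite -natrM -natrD; apply/eq_natZp; rewrite /a big_ord_recl big_ord_recr /=.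
rewrite addn0 expn0 muln1 mulnDr addnA mulnCA -expnS -[RHS]modnDmr modnMl addn0.
congr ((_ + _) %% _)%N; rewrite big_distrr; apply: eq_bigr => i _ /=.
by rewrite /bump /= add1n addnS addSn mulnCA -expnS.
Qed.

End PadicIntegerLemmas.

(** * The integral closure of Z_p in F: separation and completeness for powers of p *)

Section RingOfIntegers.
Variables (p : nat) (p_pr : prime p) (F : fieldExtType (Qp p_pr)).
Local Notation Zp := (Zp_of p_pr).
Local Notation O := (integers F).

Lemma Zp_in_inj : injective (Zp_in F : Zp -> F).
Proof.
move=> x y /eqP; rewrite -subr_eq0 -rmorphB /= scaler_eq0 oner_eq0 orbF.
by rewrite tofrac_eq0 subr_eq0 => /eqP.
Qed.

Fact int_of_padic_subproof (x : Zp) : Zp_in F x \in @integral_over_Zp _ _ F.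
Proof. by apply/asboolP; exact: integral_id. Qed.
Definition int_of_padic (x : Zp) : O := Sub (Zp_in F x) (int_of_padic_subproof x).

Fact int_of_padic_zmod : zmod_morphism int_of_padic.
Proof. by move=> x y; apply: val_inj; exact: (rmorphB (Zp_in F)). Qed.
HB.instance Definition _ := GRing.isZmodMorphism.Build Zp O int_of_padic int_of_padic_zmod.
Fact int_of_padic_monoid : monoid_morphism int_of_padic.
Proof.
by split=> [|x y]; apply: val_inj; [exact: (rmorph1 (Zp_in F))|exact: (rmorphM (Zp_in F))].
Qed.
HB.instance Definition _ := GRing.isMonoidMorphism.Build Zp O int_of_padic int_of_padic_monoid.

Lemma int_of_padic_inj : injective int_of_padic.
Proof. by move=> x y /(congr1 val) /= /Zp_in_inj. Qed.

Lemma int_integral (x : O) :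
  exists2 P : {poly Zp}, P \is monic & (map_poly int_of_padic P).[x] = 0.
Proof.
have /asboolP[P mP /rootP Px] := valP x; exists P => //; apply: val_inj.
rewrite [RHS]rmorph0 -Px -[val _]/(int_incl F _) -horner_map -map_poly_comp.
by congr (_.[_]); apply: eq_map_poly.
Qed.

(** If p y = 1, then p^n times a monic equation of degree n of y reads 1 + p S = 0 with S in Z_p. *)
Lemma int_p_nonunit : ~ exists y : O, p%:R * y = 1.
Proof.
move=> [y py]; have [P mP Py] := int_integral y.
have [n Pn] : exists n, size P = n.+1.
  by exists (size P).-1; rewrite prednK // size_poly_gt0 monic_neq0.
pose S := \sum_(i < n) P`_i * p%:R ^+ (n - i.+1).
apply: (@padic_1_neq_pM p p_pr (- S)); apply: int_of_padic_inj.
have : p%:R ^+ n * (map_poly int_of_padic P).[y] = 0 by rewrite Py mulr0.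
rewrite (@horner_coef_wide _ n.+1) -?Pn ?size_poly // Pn mulr_sumr big_ord_recr /=.
have yX i : (i <= n)%N -> p%:R ^+ n * y ^+ i = p%:R ^+ (n - i) :> O.
  by move=> le_in; rewrite -{1}(subnK le_in) exprD -mulrA -exprMn py expr1n mulr1.
rewrite mulrCA yX // subnn mulr1 coef_map /=.
have -> : P`_n = 1 by rewrite -(monicP mP) lead_coefE Pn.
rewrite rmorph1 addrC => /eqP; rewrite addr_eq0 => /eqP ->.
rewrite rmorphM rmorphN rmorph_nat mulrN rmorph_sum mulr_sumr; congr (- _).
apply: eq_bigr => i _; rewrite coef_map /= mulrCA yX; last by apply: ltnW.
by rewrite rmorphM rmorphXn rmorph_nat mulrCA -exprS -subSn.
Qed.

Lemma int_p_neq0 : (p%:R : O) != 0.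
Proof. by rewrite -(rmorph_nat int_of_padic) raddf_eq0 ?padic_p_neq0 //; exact: int_of_padic_inj. Qed.

Lemma int_mulIf (a b c : O) : a != 0 -> a * b = a * c -> b = c.
Proof.
move=> a0 /(congr1 (int_incl F)); rewrite !rmorphM => /mulfI h.
apply: val_inj; apply: h; apply: contraNneq a0 => a0; apply/eqP/val_inj.
by rewrite [LHS]a0 [RHS](rmorph0 (int_incl F)).
Qed.

(** Starting from an integral equation of b, a factor X is removed, and b cancelled, as long as the
    constant term vanishes. *)
Lemma int_algebraic (b : O) : b != 0 ->
  exists2 Q : {poly Zp}, Q`_0 != 0 & (map_poly int_of_padic Q).[b] = 0.
Proof.
move=> b0.
have [Q Q0 Qb] : exists2 Q : {poly Zp}, Q != 0 & (map_poly int_of_padic Q).[b] = 0.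
  have [P mP Pb] := int_integral b; exists P => //; exact: monic_neq0.
elim/poly_ind: Q Q0 Qb => [|Q c IH]; first by rewrite eqxx.
have [->|c0] := eqVneq c 0.
  rewrite addr0 mulf_eq0 polyX_eq0 orbF => Q0.
  rewrite rmorphM /= map_polyX hornerMX => Qb; apply: IH => //.
  by apply: (int_mulIf b0); rewrite mulr0 mulrC.
by move=> _ Qb; exists (Q * 'X + c%:P) => //; rewrite coefD coefMX coefC add0r.
Qed.

(* A nonzero b divides a nonzero element of Z_p, the constant ind_term of an equation of b. *)
Lemma int_p_separated (b : O) : (forall n, exists c, b = p%:R ^+ n * c) -> b = 0.
Proof.
move=> bp; apply/eqP; apply: contrapT => /negP b0.
have [Q Q0 Qb] := int_algebraic b0.
have [m [u [Qu u0]]] := padic_neq0 (elimN eqP Q0).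
(* The constant term is p^m u with u a unit, and b divides it; a factor p^(m+1) in b would make p
   divide u. *)
have [c bc] := bp m.+1; have [u' uu] := padic_inv_exists u0.
have QX : Q = drop_poly 1 Q * 'X + (Q`_0)%:P.
  apply/polyP => -[|i]; rewrite coefD coefMX coefC ?add0r //=.
  by rewrite coef_drop_poly addr0 addn1.
pose d := - (map_poly int_of_padic (drop_poly 1 Q)).[b].
have {Qb QX} Qd : int_of_padic Q`_0 = b * d.
  move: Qb; rewrite {1}QX rmorphD rmorphM /= map_polyX map_polyC hornerMXaddC.
  by rewrite addrC => /eqP; rewrite addr_eq0 => /eqP ->; rewrite mulrN mulrC.
clearbody d; move: Qd; rewrite Qu bc exprSr rmorphM rmorphXn rmorph_nat -!mulrA.
have cancel n (x y : O) : p%:R ^+ n * x = p%:R ^+ n * y -> x = y.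
  elim: n => [|n IH]; first by rewrite !mul1r.
  by rewrite exprS -!mulrA => /(int_mulIf int_p_neq0).
move=> /cancel ud; apply: int_p_nonunit; exists (c * d * int_of_padic u').
by rewrite !mulrA -[_ * c * d]mulrA -ud -rmorphM uu rmorph1.
Qed.

Section Uniformizer.
Variables (w : O) (w_unif : uniformizer w).
Local Notation dvdw x := (exists y, x = w * y).

Lemma unif_nonunit : ~ dvdw 1.
Proof.
move=> [y wy]; have [_ /(_ w)[_ h]] := w_unif.
by apply: h; [exists 1; rewrite mulr1|exists y].
Qed.

Lemma unif_dvdp : dvdw (p%:R : O).
Proof. by apply/(w_unif.2 _).1; exact: int_p_nonunit. Qed.

Lemma unif_unit (u : O) : ~ dvdw u -> exists v, u * v = 1.
Proof. by move=> nu; apply: contrapT => h; apply: nu; apply/(w_unif.2 u).1. Qed.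

(* The lowest coefficient of Q prime to p dominates in Q(w). *)
Lemma horner_unif (Q : {poly Zp}) :
  (exists Q', Q = p%:R *: Q') \/
  exists i u v s, u * v = 1 /\ (map_poly int_of_padic Q).[w] = w ^+ i * u + p%:R * s.
Proof.
elim/poly_ind: Q => [|Q c IH]; first by left; exists 0; rewrite scaler0.
have QE : (map_poly int_of_padic (Q * 'X + c%:P)).[w] =
    (map_poly int_of_padic Q).[w] * w + int_of_padic c.
  by rewrite rmorphD rmorphM /= map_polyX map_polyC hornerMXaddC.
(* If c is a unit, so is Q(w) w + c, because w divides no unit; if c is a multiple of p, it joins
   the multiple of p already present. *)
have [/padic_dvdp[c' cE]|c0] := pselect (res c 0 = 0); last first.
  right; have [v uv] : exists v, ((map_poly int_of_padic Q).[w] * w + int_of_padic c) * v = 1.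
    apply: unif_unit => -[y yE]; have [c' cc] := padic_inv_exists c0.
    apply: unif_nonunit; exists ((y - (map_poly int_of_padic Q).[w]) * int_of_padic c').
    rewrite mulrA mulrBr -yE [w * _.[w]]mulrC [_ + int_of_padic c]addrC addrK -rmorphM cc.
    by rewrite rmorph1.
  exists 0%N, ((map_poly int_of_padic Q).[w] * w + int_of_padic c), v, 0.
  by rewrite QE expr0 mul1r mulr0 addr0.
case: IH => [[Q' QQ']|[i [u [v [s [uv Qw]]]]]].
  left; exists (Q' * 'X + c'%:P); rewrite QQ' cE scalerDr scalerAl; congr (_ + _).
  by rewrite -mul_polyC -polyCM.
right; exists i.+1, u, v, (s * w + int_of_padic c'); split=> //.
by rewrite QE Qw cE rmorphM rmorph_nat mulrDl mulrDr exprSr !mulrA addrA [_ * w * u]mulrAC.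
Qed.

(** A monic equation of w is not divisible by p, so its value at w has the form 0 = w^i u + p s with
    u a unit. *)
Lemma unif_pow_dvdp : exists e v, w ^+ e = p%:R * v.
Proof.
have [P mP Pw] := int_integral w; case: (horner_unif P) => [[Q PQ]|].
  exfalso; apply: (@padic_1_neq_pM p p_pr (lead_coef Q)).
  by rewrite -lead_coefZ -PQ (monicP mP).
move=> [i [u [v [s [uv]]]]]; rewrite Pw => /esym/eqP; rewrite addr_eq0 => /eqP wu.
exists i, (- (s * v)); rewrite mulrN mulrA -mulNr -wu.
by rewrite -mulrA uv mulr1.
Qed.

Section Residue.
Variables (k : finFieldType) (red : {rmorphism O -> k}).
Hypothesis red_residue : residue_field_map red.

Lemma red_eq0 x : red x = 0 <-> dvdw x.
Proof. by rewrite -(w_unif.2 x) red_residue.2. Qed.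

(** Expansion in powers of w whose digits are chosen lifts of the finitely many elements of k. *)
Lemma int_mod_unif_pow e :
  exists rs : seq O, forall c, exists2 r, r \in rs & exists c', c = r + w ^+ e * c'.
Proof.
have s a : {x | red x = a} by apply: cid; exact: red_residue.1.
elim: e => [|e [rs rsP]].
  by exists [:: 0] => c; exists 0; rewrite ?inE //; exists c; rewrite mul1r add0r.
exists [seq r + w ^+ e * projT1 (s a) | r <- rs, a <- enum k] => c.
have [r rrs [c' ->]] := rsP c.
have [y yE] : dvdw (c' - projT1 (s (red c'))).
  by apply/red_eq0; rewrite rmorphB; case: (s _) => /= x ->; rewrite subrr.
exists (r + w ^+ e * projT1 (s (red c'))); first by apply: allpairs_f => //; rewrite mem_enum.
by exists y; rewrite exprSr -mulrA -yE -addrA -mulrDr [projT1 _ + _]addrC subrK.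
Qed.

Lemma int_mod_p :
  exists rs : seq O, forall c, exists2 r, r \in rs & exists c', c = r + p%:R * c'.
Proof.
have [e [v we]] := unif_pow_dvdp; have [rs rsP] := int_mod_unif_pow e.
exists rs => c; have [r rrs [c' ->]] := rsP c; exists r => //.
by exists (v * c'); rewrite mulrA -we.
Qed.

(* y n = c n + c (n + 1) p + c (n + 2) p ^ 2 + ...: reducing the terms modulo p
   to finitely many representatives, with carries, leaves series in Z_p. *)
Lemma int_series (c : nat -> O) : exists y : nat -> O, forall n, y n = c n + p%:R * y n.+1.
Proof.
have [rs rsP] := int_mod_p.
have {rsP} dec a : {rq : O * O | rq.1 \in rs /\ a = rq.1 + p%:R * rq.2}.
  by apply: cid; have [r rrs [q ->]] := rsP a; exists (r, q).
pose R a := (projT1 (dec a)).1; pose Q a := (projT1 (dec a)).2.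
have aE a : a = R a + p%:R * Q a := (projT2 (dec a)).2.
have Rrs a : R a \in undup rs by rewrite mem_undup; exact: (projT2 (dec a)).1.
clearbody R Q.
pose e := fix e n := if n is n'.+1 then c n + Q (e n') else c 0%N.
pose carry n := if n is n'.+1 then Q (e n') else 0.
have eE n : e n = c n + carry n by case: n => [|n] //=; rewrite addr0.
(* For each representative r, the positions where r occurs give a series in Z_p with digits 0 and
   1. *)
have zE r : {z : nat -> Zp | forall n, z n = (R (e n) == r)%:R + p%:R * z n.+1}.
  by apply: cid; exact: padic_digits (fun n => R (e n) == r : nat).
pose x n := \sum_(r <- undup rs) int_of_padic (projT1 (zE r) n) * r.
have xE n : x n = R (e n) + p%:R * x n.+1.
  rewrite /x mulr_sumr (eq_bigr (fun r => (R (e n) == r)%:R * r +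
      p%:R * (int_of_padic (projT1 (zE r) n.+1) * r))); last first.
    by move=> r _; case: (zE r) => /= z ->; rewrite rmorphD rmorphM !rmorph_nat mulrDl mulrA.
  rewrite big_split /=; congr (_ + _); rewrite (bigD1_seq (R (e n))) ?undup_uniq //=.
  rewrite eqxx mul1r big1 ?addr0 // => r; rewrite eq_sym => /negbTE ->.
  by rewrite mul0r.
(* The carry into position n is part of [e n] but not of the series of [c] that starts at n. *)
exists (fun n => x n - carry n) => n; rewrite mulrBr {1}xE /=.
rewrite -[c n](addrK (carry n)) -eE {2}[e n]aE.
rewrite [X in _ = X + _]addrAC -[RHS]addrA [_ + (_ - _)]addrCA subrr addr0.
by rewrite addrAC.
Qed.

(** The limit is the telescoping series; its tails y n give the congruences, as the limit minus f n
    is p^n y n. *)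
Lemma int_p_complete (f : nat -> O) :
  (forall n, exists c, f n.+1 = f n + p%:R ^+ n * c) ->
  exists y, forall n, exists c, y = f n + p%:R ^+ n * c.
Proof.
move=> /choice[c cE]; have [y yE] := int_series c.
exists (f 0%N + y 0%N) => n; exists (y n); elim: n => [|n ->]; first by rewrite mul1r.
by rewrite yE cE mulrDr addrA mulrA -exprSr.
Qed.

End Residue.
End Uniformizer.
End RingOfIntegers.

(** * Lifting points of smooth schemes *)

Section AlgebraHoms.
Variables (R : comNzRingType) (A B : comAlgType R).

Lemma lrmorphism_ext (f g : {lrmorphism A -> B}) : f =1 g -> f = g.
Proof.
case: f g => [f cf] [g cg] /= /funext fg; case: g / fg cg => cg.
by congr GRing.LRMorphism.Pack; case: cf cg => [[?] [?] [?]] [[?] [?] [?]];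
  congr GRing.LRMorphism.Class; congr (_ _); exact: Prop_irrelevance.
Qed.

Variable f : A -> B.
Definition alg_hom : Prop := [/\ {morph f : a b / a + b}, {morph f : a b / a * b},
  f 1 = 1 & forall c a, f (c *: a) = c *: f a].
Hypothesis f_hom : alg_hom.

Definition hom_of of alg_hom : A -> B := f.
Local Notation g := (hom_of f_hom).
Fact hom_of_zmod : zmod_morphism g.
Proof.
have [fD _ _ fZ] := f_hom; move=> a b.
by rewrite /hom_of -[- b]scaleN1r fD fZ scaleN1r.
Qed.
HB.instance Definition _ := GRing.isZmodMorphism.Build A B g hom_of_zmod.
Fact hom_of_monoid : monoid_morphism g.
Proof. by have [_ fM f1 _] := f_hom; split. Qed.
HB.instance Definition _ := GRing.isMonoidMorphism.Build A B g hom_of_monoid.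
Fact hom_of_scalable : scalable g.
Proof. by have [_ _ _ fZ] := f_hom. Qed.
HB.instance Definition _ := GRing.isScalable.Build R A B *:%R g hom_of_scalable.

Definition lrmorphism_of : {lrmorphism A -> B} := g.
End AlgebraHoms.

Section Ideals.
Variable R : comNzRingType.
Implicit Types I J : set R.

(** Proper ideals, so that the quotient is a nonzero ring. *)
Definition ideal I : Prop :=
  [/\ I 0, ~ I 1 & forall a u v, I u -> I v -> I (a * u + v)].

Section QuotientRing.
Variables (I : set R) (I_ideal : ideal I).
Definition ideal_pred of ideal I : {pred R} := fun x => `[< I x >].
Fact ideal_pred_closed : idealr_closed (ideal_pred I_ideal).
Proof.
have [I0 I1 IM] := I_ideal; split; first exact/asboolP.
  by apply/negP => /asboolP.
by move=> a u v /asboolP Iu /asboolP Iv; apply/asboolP; exact: IM.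
Qed.
HB.instance Definition _ := isIdealr.Build R (ideal_pred I_ideal) ideal_pred_closed.
End QuotientRing.

Lemma ideal_quotient I : ideal I -> exists (S : comNzRingType) (s : {rmorphism R -> S}),
  (forall b, exists a, s a = b) /\ forall a, s a = 0 <-> I a.
Proof.
move=> idI; pose Q : comNzRingType := {ideal_quot (ideal_pred idI)}.
pose s : {rmorphism R -> Q} := \pi_{ideal_quot (ideal_pred idI)}%qT.
exists Q, s; split=> [b|a]; first by exists (repr b); exact: reprK.
rewrite -(rmorph0 s); split=> [/eqP|Ia].
  by rewrite /s -Quotient.idealrBE subr0 => /asboolP.
by apply/eqP; rewrite /s -Quotient.idealrBE subr0; apply/asboolP.
Qed.

(** A homomorphism of algebras from A to R / I, represented by a map of sets into R so that no
    quotient enters the type when I varies. *)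
Definition hom_mod (A : comAlgType R) I (f : A -> R) : Prop :=
  [/\ forall a b, I (f (a + b) - (f a + f b)), forall a b, I (f (a * b) - f a * f b),
      I (f 1 - 1) & forall c a, I (f (c *: a) - c * f a)].

(** Formal smoothness is applied to R / I -> R / J, whose kernel J / I has square zero. *)
Lemma smooth_lift (A : comAlgType R) I J (f : A -> R) :
    formally_smooth A -> ideal I -> ideal J -> I `<=` J ->
    (forall a b, J a -> J b -> I (a * b)) -> hom_mod J f ->
  exists g : A -> R, hom_mod I g /\ forall a, J (g a - f a).
Proof.
move=> smA idI idJ IJ JJ [fD fM f1 fZ].
have [S [s [s_surj sI]]] := ideal_quotient idI.
have [T [t [t_surj tJ]]] := ideal_quotient idJ.
have tE a b : J (a - b) -> t a = t b.
  by move=> /tJ /eqP; rewrite rmorphB subr_eq0 => /eqP.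
have sE a b : s a = s b -> I (a - b) by move=> ab; apply/sI; rewrite rmorphB ab subrr.
have [r rK] := choice s_surj.
have rE a b : s a = b -> t (r b) = t a.
  by move=> <-; apply/tE/IJ/sE; rewrite rK.
have q_hom : @alg_hom _ (alg_along s) (alg_along t) (t \o r).
  split=> [a b|a b||c a].
  - by rewrite /= -rmorphD; apply: rE; rewrite rmorphD !rK.
  - by rewrite /= -rmorphM; apply: rE; rewrite rmorphM !rK.
  - by rewrite -[RHS](rmorph1 t); apply: rE; rewrite rmorph1.
  - by rewrite -[RHS](rmorphM t); apply: rE; rewrite rmorphM rK.
have f_hom : @alg_hom _ A (alg_along t) (t \o f).
  split=> [a b|a b||c a].
  - by rewrite /= -rmorphD; exact: tE.
  - by rewrite /= -rmorphM; exact: tE.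
  - by rewrite -[RHS](rmorph1 t); exact: tE.
  - by rewrite -[RHS](rmorphM t); exact: tE.
have [||x xE] := smA (alg_along s) (alg_along t) (lrmorphism_of q_hom) _ _ (lrmorphism_of f_hom).
- by move=> b; have [a <-] := t_surj b; exists (s a); exact: rE.
- move=> a b; rewrite -[a]rK -[b]rK => qa qb; rewrite -[LHS](rmorphM s); apply/sI/JJ; apply/tJ.
    by rewrite -[RHS]qa; apply/esym/rE.
  by rewrite -[RHS]qb; apply/esym/rE.
exists (r \o x); split; last by move=> a; apply/tJ; rewrite rmorphB [t _](xE a) subrr.
split=> [a b|a b||c a] /=; apply: sE.
- by rewrite [RHS]rmorphD !rK; exact: (rmorphD x).
- by rewrite [RHS]rmorphM !rK; exact: (rmorphM x).
- by rewrite rK [RHS]rmorph1; exact: (rmorph1 x).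
- by rewrite [RHS]rmorphM !rK; exact: (linearZ_LR x).
Qed.
End Ideals.

(** * Hensel lifting from the residue field to the ring of integers *)

Section Hensel.
Variables (p : nat) (p_pr : prime p) (F : fieldExtType (Qp p_pr)).
Local Notation O := (integers F).
Variables (w : O) (w_unif : uniformizer w).
Variables (k : finFieldType) (red : {rmorphism O -> k}).
Hypothesis red_residue : residue_field_map red.

Definition unif_pow n : set O := [set x | exists y, x = w ^+ n * y].

Lemma unif_pow_ideal n : ideal (unif_pow n.+1).
Proof.
split=> [|[y y1]|a u v [x ->] [y ->]]; first by exists 0; rewrite mulr0.
  by apply: (unif_nonunit w_unif); exists (w ^+ n * y); rewrite mulrA -exprS.
by exists (a * x + y); rewrite mulrDr mulrCA.
Qed.

(** Successive lifts [f n], homomorphisms modulo w^(n+1), have a limit by completeness; it is an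
    exact homomorphism because no nonzero element of O_F is divisible by all powers of p. *)
Lemma smooth_points_lift (A : comAlgType O) (x : {lrmorphism A -> alg_along red}) :
  formally_smooth A ->
  exists y : {lrmorphism A -> O^o}, forall a, red (y a) = x a.
Proof.
move=> smA.
have redw a : red a = 0 -> unif_pow 1 a.
  by move=> /(red_eq0 w_unif red_residue).
have wred a : unif_pow 1 a -> red a = 0.
  by move=> ?; apply/(red_eq0 w_unif red_residue).
have redE a b : red a = red b <-> unif_pow 1 (a - b).
  split=> [ab|/wred/eqP]; first by apply: redw; rewrite rmorphB ab subrr.
  by rewrite rmorphB subr_eq0 => /eqP.
have [f0 f0E] := choice red_residue.1.
have hom0 : hom_mod (unif_pow 1) (f0 \o x).
  split=> [a b|a b||c a]; apply/redE => /=.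
  - by rewrite [RHS]rmorphD !f0E; exact: (rmorphD x).
  - by rewrite [RHS]rmorphM !f0E; exact: (rmorphM x).
  - by rewrite f0E [RHS]rmorph1; exact: (rmorph1 x).
  - by rewrite [RHS]rmorphM !f0E; exact: (linearZ_LR x).
have step n (f : A -> O) : hom_mod (unif_pow n.+1) f ->
    exists g, hom_mod (unif_pow n.+2) g /\ forall a, unif_pow n.+1 (g a - f a).
  apply: smooth_lift => //; try exact: unif_pow_ideal.
    by move=> _ [y ->]; exists (w * y); rewrite mulrA -exprSr.
  (* The kernel has square zero: 2 (n + 1) = (n + 2) + n. *)
  move=> _ _ [a ->] [b ->]; exists (w ^+ n * (a * b)).
  by rewrite mulrACA -exprD !mulrA -exprD addSnnS addnC.
have {step} [f [f00 [homf fS]]] : exists f : nat -> A -> O, f 0%N = f0 \o x /\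
    (forall n, hom_mod (unif_pow n.+1) (f n)) /\ forall n a, unif_pow n.+1 (f n.+1 a - f n a).
  pose T n := {f : A -> O | hom_mod (unif_pow n.+1) f}.
  have stepT n (f : T n) := cid (step n (sval f) (svalP f)).
  pose F0 := fix F0 n : T n := if n is n'.+1
    then exist _ (sval (stepT n' (F0 n'))) (svalP (stepT n' (F0 n'))).1
    else exist _ _ hom0.
  exists (fun n => sval (F0 n)); split=> //; split=> n; first exact: svalP.
  exact: (svalP (stepT n (F0 n))).2.
have [e [v we]] := unif_pow_dvdp w_unif.
have fle m n a : (m <= n)%N -> unif_pow m.+1 (f n a - f m a).
  elim: n => [|n IH]; first by rewrite leqn0 => /eqP ->; exists 0; rewrite subrr mulr0.
  rewrite leq_eqVlt => /predU1P[->|]; first by exists 0; rewrite subrr mulr0.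
  rewrite ltnS => le_mn; have [y yE] := IH le_mn; have [z zE] := fS n a.
  exists (w ^+ (n - m) * z + y); rewrite mulrDr mulrA -exprD addSn subnKC // -yE -zE.
  by rewrite addrA subrK.
(* Since w^(e n) is a multiple of p^n, the terms of index e n converge along powers of p. *)
pose h n := f (e * n)%N.
have homh n : hom_mod (unif_pow (e * n).+1) (h n) := homf _.
have wp n a : unif_pow (e * n).+1 a -> exists c, a = p%:R ^+ n * c.
  move=> [y ->]; exists (w * v ^+ n * y).
  by rewrite exprSr exprM we exprMn !mulrA [_ * w]mulrC [w * (_ * _)]mulrCA mulrA.
have lim a : exists y, forall n, exists c, y = h n a + p%:R ^+ n * c.
  apply: (int_p_complete w_unif red_residue) => n.
  have [|c cE] := wp n (h n.+1 a - h n a); last by exists c; rewrite -cE addrC subrK.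
  by apply: fle; rewrite leq_mul2l leqnSn orbT.
have {lim} [y yE] := choice lim.
have hE n a b : unif_pow (e * n).+1 (a - b) -> exists c, a = b + p%:R ^+ n * c.
  by move=> /wp[c cE]; exists c; rewrite -cE addrC subrK.
have y0 (a b : O) : (forall n, exists c, a - b = p%:R ^+ n * c) -> a = b.
  by move=> ab; apply/eqP; rewrite -subr_eq0; apply/eqP; exact: int_p_separated.
have y_hom : @alg_hom _ A O^o y.
  split=> [a b|a b||c a]; apply: y0 => n; have [fD fM f1 fZ] := homh n.
  - have [c1 ->] := yE (a + b) n; have [c2 ->] := yE a n; have [c3 ->] := yE b n.
    have [d ->] := hE n _ _ (fD a b); exists (d + c1 - c2 - c3); ring.
  - have [c1 ->] := yE (a * b) n; have [c2 ->] := yE a n; have [c3 ->] := yE b n.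
    have [d ->] := hE n _ _ (fM a b).
    exists (d + c1 - h n a * c3 - c2 * h n b - p%:R ^+ n * c2 * c3); ring.
  - have [c1 ->] := yE 1 n; have [d ->] := hE n _ _ f1; exists (d + c1); ring.
  - have [c1 ->] := yE (c *: a) n; have [c2 ->] := yE a n.
    have [d ->] := hE n _ _ (fZ c a); exists (d + c1 - c * c2).
    rewrite -[_ *: _]/(c * _); ring.
exists (lrmorphism_of y_hom) => a; have [c yc] := yE a 1%N.
rewrite [lrmorphism_of _ a]yc /h muln1 expr1 rmorphD rmorphM.
have -> : red p%:R = 0 by apply/(red_eq0 w_unif red_residue); exact: unif_dvdp.
rewrite mul0r addr0 -(f0E (x a)) -[f0 (x a)]/((f0 \o x) a) -f00.
by apply/redE; exact: fle.
Qed.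

End Hensel.

(** * Continuity of translations and finiteness of double_cosets *)

Lemma fraction_split (R : idomainType) (c : {fraction R}) :
  exists n d : R, d != 0 /\ FracField.tofrac d * c = FracField.tofrac n.
Proof.
elim/quotW: c => r; exists r.1, r.2; split; first exact: denom_ratioP.
unlock FracField.tofrac; rewrite -[LHS]FracField.pi_mul.
apply/eqmodP; rewrite /= FracField.equivfE /FracField.mulf.
by rewrite !numden_Ratio ?mulf_neq0 ?oner_neq0 ?denom_ratioP // !mul1r mulr1 mulrC.
Qed.

(** A denominator is p^m times a unit of Z_p, and the unit moves to the numerator. *)
Lemma Qp_denominator p (p_pr : prime p) (c : Qp p_pr) :
  exists r (z : Zp_of p_pr), p%:R ^+ r * c = FracField.tofrac z.
Proof.
have [n [d [d0 dc]]] := fraction_split c.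
have [m [u [dE u0]]] := padic_neq0 (elimN eqP d0).
have [y uy] := padic_inv_exists u0.
exists m, (y * n); rewrite rmorphM /= -dc mulrA -rmorphM dE mulrCA [y * u]mulrC uy mulr1.
by rewrite rmorphXn rmorph_nat.
Qed.

Section Denominators.
Variables (p : nat) (p_pr : prime p) (F : fieldExtType (Qp p_pr)).
Local Notation Zp := (Zp_of p_pr).
Local Notation O := (integers F).

(** If p^r clears the denominators of the minimal polynomial q of x, of degree n, then p^r x is a
    root of the monic polynomial with coefficients p^(r (n - i)) q_i. *)
Lemma integers_denominator (x : F) : exists r (c : O), p%:R ^+ r * x = int_incl F c.
Proof.
have [q qE] : exists q, minPoly 1%VS x = map_poly (in_alg F) q.
  exact/polyOver1P/minPolyOver.
have mq : q \is monic by rewrite -(map_monic (in_alg F)) -qE monic_minPoly.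
have qx : (map_poly (in_alg F) q).[x] = 0 by rewrite -qE; exact/rootP/root_minPoly.
have [n qn] : exists n, size q = n.+1.
  by exists (size q).-1; rewrite prednK // size_poly_gt0 monic_neq0.
have [r rE] : exists r, forall i, exists z : Zp, p%:R ^+ r * q`_i = FracField.tofrac z.
  elim/poly_ind: (q) => [|q' c [r' r'E]].
    by exists 0%N => i; exists 0; rewrite coef0 mulr0 rmorph0.
  have [s [z sE]] := Qp_denominator c.
  exists (r' + s)%N => -[|i]; rewrite coefD coefMX coefC ?add0r ?addr0 exprD /=.
    by exists (p%:R ^+ r' * z); rewrite -mulrA sE rmorphM rmorphXn rmorph_nat.
  have [z' zE] := r'E i; exists (p%:R ^+ s * z').
  by rewrite mulrAC zE rmorphM rmorphXn rmorph_nat mulrC.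
have [z zE] := choice rE.
(* One factor p^r is contained in z_i = p^r q_i, whence the exponent n - i.+1. *)
pose P : {poly Zp} := \poly_(i < n.+1) (if i == n then 1 else p%:R ^+ (r * (n - i.+1)) * z i).
have PE (i : 'I_n.+1) : (map_poly (Zp_in F) P)`_i =
    p%:R ^+ (r * (n - i)) * (map_poly (in_alg F) q)`_i.
  rewrite !coef_map -[LHS]/(Zp_in F P`_i) -[X in _ = _ * X]/(in_alg F q`_i).
  rewrite coef_poly ltn_ord; case: eqVneq => [->|ni].
    have -> : q`_n = 1 by rewrite -(monicP mq) lead_coefE qn.
    by rewrite subnn muln0 mul1r (rmorph1 (in_alg F)) (rmorph1 (Zp_in F)).
  have lt_in : (i < n)%N by rewrite ltn_neqAle ni -ltnS ltn_ord.
  rewrite (rmorphM (Zp_in F)) (rmorphXn (Zp_in F)) (rmorph_nat (Zp_in F)).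
  have -> : Zp_in F (z i) = p%:R ^+ r * in_alg F q`_i.
    by rewrite -[LHS]/(in_alg F (FracField.tofrac (z i))) -zE rmorphM rmorphXn rmorph_nat.
  by rewrite mulrA -exprD -mulnSr -subSn // subSS.
have Pn : P`_n = 1 by rewrite coef_poly ltnSn eqxx.
have mP : P \is monic.
  have sP : size P = n.+1.
    apply/eqP; rewrite eqn_leq size_poly /= ltnNge; apply/negP => /leq_sizeP/(_ n (leqnn _)).
    by rewrite Pn => /eqP; rewrite oner_eq0.
  by rewrite monicE lead_coefE sP Pn.
have Px : (map_poly (Zp_in F) P).[p%:R ^+ r * x] = 0.
  rewrite (@horner_coef_wide _ n.+1); last first.
    by apply: leq_trans (size_poly _ _) _; exact: size_poly.
  move: qx; rewrite (@horner_coef_wide _ n.+1) => [qx|]; last by rewrite -qn; exact: size_poly.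
  apply: etrans (etrans (congr1 (fun y => p%:R ^+ (r * n) * y) qx) (mulr0 _)).
  rewrite mulr_sumr; apply: eq_bigr => i _; rewrite PE exprMn mulrACA -exprM.
  by rewrite -exprD -mulnDr subnK ?leq_ord.
have xO : p%:R ^+ r * x \in @integral_over_Zp _ _ F.
  by apply/asboolP; exists P => //; exact/rootP.
by exists r, (Sub (p%:R ^+ r * x) xO).
Qed.
End Denominators.

Section PadicContinuity.
Variables (p : nat) (p_pr : prime p) (F : fieldExtType (Qp p_pr)).
Local Notation O := (integers F).
Variable G : group_scheme O.
Local Notation GF := (local_points G).

Lemma padic_closeD m (x y x' y' : F) :
  padic_close m x y -> padic_close m x' y' -> padic_close m (x + x') (y + y').
Proof. by move=> [c xy] [d xy']; exists (c + d); rewrite rmorphD mulrDr -xy -xy' opprD addrACA. Qed.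

Lemma padic_closeN m (x y : F) : padic_close m x y -> padic_close m (- x) (- y).
Proof. by move=> [c xy]; exists (- c); rewrite rmorphN mulrN -xy opprD. Qed.

Definition near_point (s : seq G) (n : nat) (g : GF) : set GF :=
  [set h | forall a, a \in s -> padic_close n (local_coord a h) (local_coord a g)].

Lemma near_pointI s n s' n' g :
  near_point (s ++ s') (maxn n n') g `<=` near_point s n g `&` near_point s' n' g.
Proof.
move=> h gh; split=> a ha; apply: padic_close_le (gh a _).
- exact: leq_maxl.
- by rewrite mem_cat ha.
- exact: leq_maxr.
- by rewrite mem_cat ha orbT.
Qed.

HB.instance Definition _ := isPointed.Build GF 1%g.

Definition padic_continuous : {pred GF -> F} := fun f => `[< forall (g : GF) m,
  exists s n, forall h : GF, near_point s n g h -> padic_close m (f h) (f g) >].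

Fact padic_continuous_subring : subring_closed padic_continuous.
Proof.
split=> [|f f' /asboolP hf /asboolP hf'|f f' /asboolP hf /asboolP hf'];
  apply/asboolP => g m.
- by exists [::], 0%N => h _; exists 0; rewrite rmorph0 mulr0 subrr.
- have [s [n hs]] := hf g m; have [s' [n' hs']] := hf' g m.
  exists (s ++ s'), (maxn n n') => h /near_pointI[gh gh'].
  by apply: padic_closeD; [exact: hs|apply: padic_closeN; exact: hs'].
(* Each factor is approximated with extra precision equal to the exponent of the denominator of the
   other. *)
- have [r [c cE]] := integers_denominator (f g).
  have [r' [c' cE']] := integers_denominator (f' g).
  have [s [n hs]] := hf g (m + r')%N; have [s' [n' hs']] := hf' g (m + r)%N.
  exists (s ++ s'), (maxn n n') => h /near_pointI[/hs[d dE] /hs'[d' dE']].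
  exists (d * c' + d' * c + p%:R ^+ (m + r + r') * d * d').
  rewrite -[LHS]/(f h * f' h - f g * f' g).
  have -> : f h = f g + p%:R ^+ (m + r') * int_incl F d by rewrite -dE addrC subrK.
  have -> : f' h = f' g + p%:R ^+ (m + r) * int_incl F d' by rewrite -dE' addrC subrK.
  rewrite !rmorphD !rmorphM !rmorphXn !rmorph_nat -cE -cE' !exprD; ring.
Qed.
HB.instance Definition _ := GRing.isSubringClosed.Build (GF -> F) padic_continuous
  padic_continuous_subring.

Definition cont_fun : Type := {f : GF -> F | f \in padic_continuous}.
HB.instance Definition _ := [isSub of cont_fun for sval].
HB.instance Definition _ := [Choice of cont_fun by <:].
HB.instance Definition _ := [SubChoice_isSubComNzRing of cont_fun by <:].

Fact cont_const_subproof (x : F) : (fun _ : GF => x) \in padic_continuous.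
Proof.
by apply/asboolP => g m; exists [::], 0%N => h _; exists 0; rewrite rmorph0 mulr0 subrr.
Qed.
Definition cont_const (x : O) : cont_fun :=
  Sub (fun _ : GF => int_incl F x) (cont_const_subproof (int_incl F x)).
Fact cont_const_zmod : zmod_morphism cont_const.
Proof. by move=> x y; apply: val_inj; apply: funext => g; exact: (rmorphB (int_incl F)). Qed.
HB.instance Definition _ := GRing.isZmodMorphism.Build O cont_fun cont_const cont_const_zmod.
Fact cont_const_monoid : monoid_morphism cont_const.
Proof.
split=> [|x y]; apply: val_inj; apply: funext => g; first exact: (rmorph1 (int_incl F)).
exact: (rmorphM (int_incl F)).
Qed.
HB.instance Definition _ := GRing.isMonoidMorphism.Build O cont_fun cont_const cont_const_monoid.

Local Notation S := (alg_along cont_const).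
Local Notation FA := (alg_along (int_incl F)).

Definition cont_eval (g : GF) (f : cont_fun) : F := val f g.

Fact cont_eval_hom g : @alg_hom _ S FA (cont_eval g).
Proof. by split. Qed.

Fact cont_const_hom (g : GF) : @alg_hom _ G S
  (fun a => Sub (fun _ : GF => local_coord a g) (cont_const_subproof _)).
Proof.
split=> [a b|a b||c a]; apply: val_inj; apply: funext => h; rewrite /= /local_coord /coord_at.
- exact: (rmorphD (g : {lrmorphism G -> FA})).
- exact: (rmorphM (g : {lrmorphism G -> FA})).
- exact: (rmorph1 (g : {lrmorphism G -> FA})).
- exact: (linearZ_LR (g : {lrmorphism G -> FA})).
Qed.

Fact coord_continuous a : (fun g => local_coord a g) \in padic_continuous.
Proof. by apply/asboolP => g m; exists [:: a], m => h; apply; rewrite inE. Qed.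
Fact cont_generic_hom : @alg_hom _ G S (fun a => Sub (fun g => local_coord a g) (coord_continuous a)).
Proof.
split=> [a b|a b||c a]; apply: val_inj; apply: funext => h; rewrite /= /local_coord /coord_at.
- exact: (rmorphD (h : {lrmorphism G -> FA})).
- exact: (rmorphM (h : {lrmorphism G -> FA})).
- exact: (rmorph1 (h : {lrmorphism G -> FA})).
- exact: (linearZ_LR (h : {lrmorphism G -> FA})).
Qed.

(* The constant point g and the generic point have values in the ring of continuous functions,
   hence so does their product. *)
Lemma translation_continuous (g : GF) a :
  (fun h => local_coord a (g * h)%g) \in padic_continuous.
Proof.
pose x : points G S := lrmorphism_of (cont_const_hom g).
pose y : points G S := lrmorphism_of cont_generic_hom.
suff -> : (fun h => local_coord a (g * h)%g) = val (coord_at a (x * y)%g : cont_fun).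
  exact: valP.
apply: funext => h.
pose ev : {lrmorphism S -> FA} := lrmorphism_of (cont_eval_hom h).
rewrite -[RHS]/(coord_at a (point_map ev (x * y)%g)).
have -> : point_map ev (x * y)%g = (point_map ev x * point_map ev y)%g by exact: gs_natural.
have -> : point_map ev x = g by exact: lrmorphism_ext.
by have -> : point_map ev y = h by exact: lrmorphism_ext.
Qed.

End PadicContinuity.

(** * The subgroup K of G(F), its reduction to G(k) and its open cosets *)

Section IntegralPoints.
Variables (p : nat) (p_pr : prime p) (F : fieldExtType (Qp p_pr)).
Local Notation O := (integers F).
Variable G : group_scheme O.
Local Notation GF := (local_points G).
Local Notation K := (integral_points G).
Local Notation i := (@int_to_local _ _ F G).

Lemma int_to_localM (h h' : K) : i (h * h')%g = (i h * i h')%g.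
Proof. exact: gs_natural. Qed.

Lemma int_to_local1 : i 1%g = 1%g.
Proof. by apply: (@mulgI _ (i 1%g)); rewrite -int_to_localM !mulg1. Qed.

Lemma int_to_localV (h : K) : i h^-1%g = (i h)^-1%g.
Proof. by apply: (@mulgI _ (i h)); rewrite -int_to_localM !mulgV int_to_local1. Qed.

Lemma reductionM (k : finFieldType) (red : {rmorphism O -> k}) (h h' : K) :
  reduction red (h * h')%g = (reduction red h * reduction red h')%g.
Proof. exact: gs_natural. Qed.

Lemma reduction1 (k : finFieldType) (red : {rmorphism O -> k}) :
  reduction red (1%g : K) = 1%g.
Proof. by apply: (@mulgI _ (reduction red (1%g : K))); rewrite -reductionM !mulg1. Qed.

Lemma reduction_surjective (w : O) (k : finFieldType) (red : {rmorphism O -> k}) :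
  uniformizer w -> residue_field_map red -> formally_smooth G ->
  forall g, exists h : K, reduction red h = g.
Proof.
move=> w_unif red_res smG g.
have [h hE] := smooth_points_lift w_unif red_res (g : {lrmorphism G -> alg_along red}) smG.
by exists h; apply: lrmorphism_ext.
Qed.

Lemma int_to_local_surj (g : GF) :
  (forall a, local_coord a g \in @integral_over_Zp _ _ F) -> exists h, g = i h.
Proof.
move=> gO; pose f (a : G) : O^o := Sub (local_coord a g) (gO a).
pose g' : {lrmorphism G -> alg_along (int_incl F)} := g.
have f_hom : @alg_hom _ G O^o f.
  split=> [a b|a b||c a]; apply: val_inj.
  - exact: (rmorphD g').
  - exact: (rmorphM g').
  - exact: (rmorph1 g').
  - exact: (linearZ_LR g').
by exists (lrmorphism_of f_hom); apply: lrmorphism_ext.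
Qed.

(** A point y lies in gK when all coordinates of g^-1 y are integral, and finitely many generators
    of the coordinate algebra decide this. By continuity of translation, near g h0 these differ from
    the integral coordinates of h0 by elements of O_F. *)
Lemma left_coset_open (g : GF) : finite_type G ->
  open [set (g * i h)%g | h in [set: K]].
Proof.
move=> [gens gensP]; rewrite /open /=.
move=> x [h0 _ <-].
have cont b : exists s n, forall y : GF, near_point s n (g * i h0)%g y ->
    padic_close 0 (local_coord b (g^-1 * y)%g) (local_coord b (g^-1 * (g * i h0))%g).
  by have /asboolP/(_ (g * i h0)%g 0%N) := translation_continuous g^-1%g b.
have [s [n sn]] : exists s n, forall y : GF, near_point s n (g * i h0)%g y -> 
    forall b, b \in gens -> padic_close 0 (local_coord b (g^-1 * y)%g) (local_coord b (i h0)).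
  elim: gens {gensP} => [|b gens [s [n IH]]]; first by exists [::], 0%N.
  have [s' [n' sn']] := cont b.
  exists (s ++ s'), (maxn n n') => y /near_pointI[/IH hy /sn'].
  rewrite mulKg => hb b'; rewrite inE => /predU1P[->//|]; exact: hy.
exists s, n => y /sn hy.
have [|h yh] := @int_to_local_surj (g^-1 * y)%g; last first.
  by exists h => //; rewrite -yh mulVKg.
pose B := [set a : G | local_coord a (g^-1 * y)%g \in @integral_over_Zp _ _ F].
suff BT : B = setT by move=> a; have : B a by rewrite BT.
pose x' : {lrmorphism G -> alg_along (int_incl F)} := (g^-1 * y)%g.
apply: gensP => [a /hy[c ac]|c|a b Ba Bb|a b Ba Bb]; rewrite /B /=.
- rewrite -[local_coord _ _](subrK (local_coord a (i h0))) ac mul1r.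
  by apply: rpredD; exact: valP.
- have -> : local_coord (c *: 1) (g^-1 * y)%g = int_incl F c.
    by apply: etrans (linearZ_LR x' c 1) _; rewrite rmorph1; exact: mulr1.
  exact: valP.
- by have -> := rmorphD x' a b : local_coord (a + b) _ = _; exact: rpredD.
- by have -> := rmorphM x' a b : local_coord (a * b) _ = _; exact: rpredM.
Qed.

Lemma compact_finite_cosets (A : set GF) : finite_type G -> compact (closure A) ->
  finite_set [set c | left_K_cosets c /\ c `&` A !=set0].
Proof.
move=> ftG; rewrite compact_cover => /(_ _ [set: GF] (fun g => [set (g * i h)%g | h in setT])).
move=> [|x _|D _ Dcov]; first by move=> g _; exact: left_coset_open.
  by exists x => //; exists 1%g => //; rewrite int_to_local1 mulg1.
apply: (@sub_finite_set _ _ [set [set (g * i h)%g | h in [set: K]] | g in [set` D]]).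
  move=> _ [[g ->] [_ [[h _ <-] Agh]]].
  have [g' Dg' [h' _ gh]] := Dcov _ (subset_closure Agh).
  exists g' => //; apply/seteqP; split=> _ [h2 _ <-].
    exists (h * h'^-1 * h2)%g => //.
    by rewrite !int_to_localM int_to_localV !mulgA -gh mulgK.
  exists (h' * h^-1 * h2)%g => //.
  by rewrite !int_to_localM int_to_localV !mulgA gh mulgK.
exact/finite_image/finite_fset.
Qed.

End IntegralPoints.

(** * The Hecke operator *)

Section HeckeKernel.
Variables (p : nat) (p_pr : prime p) (F : fieldExtType (Qp p_pr)).
Variables (k : finFieldType) (red : {rmorphism integers F -> k}).
Variables (G : group_scheme (integers F)) (C : closedFieldType).
Local Notation K := (integral_points G).
Local Notation GF := (local_points G).
Local Notation i := (@int_to_local _ _ F G).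
Variables (V : lmodType C) (rho : points G (alg_along red) -> {linear V -> V}).
Variables (W : lmodType C) (pi : GF -> {linear W -> W}).
Hypotheses (rho_rep : is_rep rho) (pi_rep : is_rep pi).
Variables (t : GF) (Nminus : set (points G (alg_along red))).
Variable Tbar : GF -> {linear V -> V}.
Hypothesis Tbar_hecke : hecke_algebra rho Tbar.
Hypothesis Tbar_support : hecke_support Tbar = K_double_coset t.
Hypothesis Tbar_fixed : forall v, fixed rho Nminus (Tbar t v).
Local Notation rhoK := (inflation rho).
Local Notation piK := (restriction pi).

Lemma inflation_rep : is_rep rhoK.
Proof.
have [rho1 rhoM] := rho_rep; split=> [v|g h v].
  exact: etrans (congr1 (fun z => rho z v) (reduction1 G red)) (rho1 v).
exact: etrans (congr1 (fun z => rho z v) (reductionM red g h)) (rhoM _ _ _).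
Qed.

Fact right_translation_linear (h : K) :
  linear (right_translation h : (K -> V) -> (K -> V)).
Proof. by []. Qed.
Definition right_trans (h : K) : {linear (K -> V) -> (K -> V)} :=
  linear_of (right_translation_linear h).

Lemma right_trans_rep : is_rep right_trans.
Proof.
split=> [phi|g h phi]; apply: funext => x.
  by rewrite -[LHS]/(phi (x * 1)%g) mulg1.
by rewrite -[RHS]/(phi (x * g * h)%g) -mulgA.
Qed.

Fact frob_Tbar_linear : linear (fun u => frob_unit rho t (Tbar t u)).
Proof.
move=> a u v; apply: funext => x; rewrite /frob_unit.
rewrite -[RHS]/(a *: (if _ then _ else _) + (if _ then _ else _)).
by case: ifP => _; rewrite ?linearP // scaler0 addr0.
Qed.
Definition frob_Tbar : {linear V -> (K -> V)} := linear_of frob_Tbar_linear.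

Lemma frob_TbarE u x :
  frob_Tbar u x = if `[< K_cap_conj t x >] then rhoK x (Tbar t u) else 0.
Proof. by []. Qed.

Lemma Tbar_equivariant h g h' v : Tbar (i h * g * i h')%g v = rhoK h (Tbar g (rhoK h' v)).
Proof. exact: Tbar_hecke.2. Qed.

(** As h t = t h', this is [Tbar] at that point, computed in two ways. *)
Lemma Tbar_conj h h' v : i h = (t * i h' * t^-1)%g ->
  rhoK h (Tbar t v) = Tbar t (rhoK h' v).
Proof.
move=> hh'; have := Tbar_equivariant h t 1%g v.
have := Tbar_equivariant 1%g t h' v.
rewrite !int_to_local1 !mulg1 !mul1g !inflation_rep.1 => <- <-.
by rewrite hh' mulgVK.
Qed.

Lemma K_cap_conjM h h' : K_cap_conj t h -> K_cap_conj t h' -> K_cap_conj t (h * h')%g.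
Proof.
move=> [a ha] [b hb]; exists (a * b)%g.
by rewrite !int_to_localM ha hb !mulgA mulgVK.
Qed.

Lemma K_cap_conjV h : K_cap_conj t h -> K_cap_conj t h^-1%g.
Proof.
move=> [a ha]; exists a^-1%g; rewrite !int_to_localV; apply: mulg1_eq.
by rewrite ha !mulgA mulgVK mulgK mulgV.
Qed.

Lemma K_cap_conj_mulr h h' : K_cap_conj t h' -> K_cap_conj t (h * h')%g <-> K_cap_conj t h.
Proof.
move=> ch'; split=> [ch|ch]; last exact: K_cap_conjM.
by rewrite -[h](mulgK h'); apply: K_cap_conjM => //; exact: K_cap_conjV.
Qed.

Lemma K_cap_conj1 : K_cap_conj t 1%g.
Proof. by exists 1%g; rewrite int_to_local1 mulg1 mulgV. Qed.

(** The map A of the overview, here [frob_Tbar], inherits from [Tbar t] the exchange of h' with its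
    conjugate by t. *)
Lemma frob_Tbar_trans h h' u : i h = (t * i h' * t^-1)%g ->
  right_trans h (frob_Tbar u) = frob_Tbar (rhoK h' u).
Proof.
move=> hh'; apply: funext => x.
rewrite -[LHS]/(frob_Tbar u (x * h)%g) !frob_TbarE.
have ch : K_cap_conj t h by exists h'.
rewrite (propext (K_cap_conj_mulr x ch)).
by case: ifP => // _; rewrite inflation_rep.2 (Tbar_conj _ hh').
Qed.

Lemma induced_submod : submod (induced rho t Nminus).
Proof.
have fix0 n : rho n 0 = 0 by exact: linear0.
split.
  by split=> [x n _|h x ch] /=; rewrite linear0.
move=> a phi psi [fphi ephi] [fpsi epsi]; split=> [x n nN|h x ch].
  by rewrite -[LHS]/(rho n (a *: phi x + psi x)) linearP /= fphi // fpsi.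
rewrite -[LHS]/(a *: phi (h * x)%g + psi (h * x)%g) ephi // epsi //.
by rewrite -linearP.
Qed.

Lemma induced_trans h phi : induced rho t Nminus phi -> induced rho t Nminus (right_trans h phi).
Proof.
move=> [f e]; split=> [x|h' x ch]; first exact: f.
by rewrite -[LHS]/(phi (h' * x * h)%g) -mulgA e.
Qed.

(** At x = t x' t^-1 the value is [Tbar t] applied to x' u, so it is still in the image of [Tbar t]
    and fixed by [Nminus]. *)
Lemma frob_Tbar_induced u : induced rho t Nminus (frob_Tbar u).
Proof.
split=> [x|h x ch]; rewrite !frob_TbarE.
  case: asboolP => [[h' xh']|_]; last by move=> n _; exact: linear0.
  by rewrite (Tbar_conj _ xh'); exact: Tbar_fixed.
have -> : `[< K_cap_conj t (h * x)%g >] = `[< K_cap_conj t x >].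
  apply/asbool_equiv_eq; split=> [hx|]; last exact: K_cap_conjM.
  by rewrite -[x](mulKg h); apply: K_cap_conjM => //; exact: K_cap_conjV.
by case: ifP => _; rewrite ?linear0 // inflation_rep.2.
Qed.

Section FixedVector.
Variable x : tensor V W.
Hypothesis x_fixed : tensor_fixed rhoK piK x.

Definition ind_term (h : K) : tensor (K -> V) W :=
  tensor_map (right_trans h \o frob_Tbar) (pi (i h * t)%g) x.

Lemma ind_term_trans h h' : tensor_map (right_trans h) (piK h) (ind_term h') = ind_term (h * h')%g.
Proof.
rewrite /ind_term tensor_map_comp; apply: eq_tensor_map => u /=.
  by rewrite right_trans_rep.2.
by rewrite -pi_rep.2 mulgA -int_to_localM.
Qed.

(** The term depends only on the coset h t K: with h' = h n and n = t m t^-1, the n-term is (A (x)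
    t) (m x), and m x = x. *)
Lemma ind_term_coset h h' m : (i h * t * i m = i h' * t)%g -> ind_term h = ind_term h'.
Proof.
move=> hh'; pose n := (h^-1 * h')%g.
have nm : i n = (t * i m * t^-1)%g.
  rewrite int_to_localM int_to_localV; apply: (@mulgI _ (i h)); rewrite mulVKg.
  by rewrite -[LHS](mulgK t) -hh' !mulgA.
have -> : h' = (h * n)%g by rewrite /n mulVKg.
rewrite -ind_term_trans -[ind_term n]/(tensor_map _ _ x).
have -> : tensor_map (right_trans n \o frob_Tbar) (pi (i n * t)%g) x =
    tensor_map frob_Tbar (pi t) x.
  rewrite -[in RHS](x_fixed m) tensor_map_comp; apply: eq_tensor_map => u /=.
    by rewrite (frob_Tbar_trans _ nm).
  by rewrite nm mulgVK pi_rep.2.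
by rewrite tensor_map_comp; apply: eq_tensor_map => // u /=; rewrite pi_rep.2.
Qed.

(** The left cosets of K inside KtK; h t K corresponds to the coset of h modulo K cap tKt^-1. *)
Definition double_cosets : set (set GF) := [set c | left_K_cosets c /\ exists h, c (i h * t)%g].
Definition coset_rep (c : set GF) : K := xget 1%g [set h | c (i h * t)%g].
Hypothesis double_cosets_finite : finite_set double_cosets.

Lemma coset_repP c : double_cosets c -> c (i (coset_rep c) * t)%g.
Proof. by move=> [_ [h ch]]; rewrite /coset_rep; case: xgetP => // /(_ h). Qed.

Lemma coset_mem c g g' : left_K_cosets c -> c g -> c g' -> exists m, (g * i m = g')%g.
Proof.
move=> [g0 ->] [h _ <-] [h' _ <-]; exists (h^-1 * h')%g.
by rewrite int_to_localM int_to_localV mulgA mulgK.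
Qed.

Lemma ind_term_rep c h : double_cosets c -> c (i h * t)%g -> ind_term (coset_rep c) = ind_term h.
Proof.
move=> cc ch; have [m hm] := coset_mem cc.1 (coset_repP cc) ch.
exact: ind_term_coset hm.
Qed.

Definition translate (h : K) (c : set GF) : set GF := [set (i h * g)%g | g in c].

Lemma translateK h : cancel (translate h) (translate h^-1%g).
Proof.
move=> c; apply/seteqP; split=> [_ [_ [g cg <-] <-]|g cg].
  by rewrite int_to_localV mulKg.
by exists (i h * g)%g; [exists g|rewrite int_to_localV mulKg].
Qed.

Lemma translate_double_cosets h c : double_cosets c -> double_cosets (translate h c).
Proof.
move=> [[g ->] [h' [m _ gm]]]; split; last first.
  exists (h * h')%g, (i h' * t)%g; last by rewrite int_to_localM mulgA.
  by exists m.
exists (i h * g)%g; apply/seteqP; split=> [_ [_ [n _ <-] <-]|_ [n _ <-]].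
  by exists n => //; rewrite mulgA.
by exists (g * i n)%g; [exists n|rewrite mulgA].
Qed.

Lemma translate_bij h : set_bij double_cosets double_cosets (translate h).
Proof.
split.
- by move=> c /(translate_double_cosets h).
- by move=> c c' _ _ /(congr1 (translate h^-1%g)); rewrite !translateK.
- move=> c cc; exists (translate h^-1%g c); first exact: translate_double_cosets.
  by rewrite -{1}[h]invgK translateK.
Qed.

(* The vector of Ind (x) pi which the Frobenius map sends to Tbar x. *)
Definition ind_vector : tensor (K -> V) W := \sum_(c \in double_cosets) ind_term (coset_rep c).

Lemma ind_vectorE : ind_vector = \sum_(c <- fset_set double_cosets) ind_term (coset_rep c).
Proof. exact: fsbig_finite. Qed.

(** Left translation by h permutes the cosets in KtK, and h maps the term of h' to that of h h'. *)
Lemma ind_vector_fixed : tensor_fixed right_trans piK ind_vector.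
Proof.
move=> h; rewrite {1}ind_vectorE linear_sum.
rewrite /ind_vector (reindex_fsbig (translate h) _ _ _ (translate_bij h)) fsbig_finite //.
rewrite !big_seq; apply: eq_bigr => c; rewrite in_fset_set // => /set_mem cc.
rewrite /= ind_term_trans; apply/esym; apply: ind_term_rep; first exact: translate_double_cosets.
by exists (i (coset_rep c) * t)%g; [exact: coset_repP|rewrite int_to_localM mulgA].
Qed.

(** Cosets outside KtK contribute 0. In h t K the representative chosen by [xget] differs from h t
    by an element of K, which x absorbs. *)
Lemma hecke_actE : hecke_act pi Tbar x =
  \sum_(c <- fset_set double_cosets)
    tensor_map (rhoK (coset_rep c) \o Tbar t) (pi (i (coset_rep c) * t)%g) x.
Proof.
rewrite /hecke_act -(@fsbig_widen _ _ _ _ double_cosets); last 2 first.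
- by move=> c [].
- move=> c [[g cE] nc] /=.
  have cg : c (xget 1%g c).
    by case: xgetP => // /(_ g) []; rewrite cE; exists 1%g; rewrite // int_to_local1 mulg1.
  have T0 v : Tbar (xget 1%g c) v = 0.
    apply: contrapT => Tv; have : hecke_support Tbar (xget 1%g c) by exists v.
    rewrite Tbar_support => -[h [h' gE]]; apply: nc; split; first by exists g.
    exists h; move: cg; rewrite gE {1}cE => -[m _ gm].
    rewrite cE; exists (m * h'^-1)%g => //.
    by rewrite int_to_localM int_to_localV mulgA gm mulgK.
  apply: contract_eq0 => l; rewrite contract_map; exact: T0.
rewrite fsbig_finite // !big_seq; apply: eq_bigr => c; rewrite in_fset_set // => /set_mem cc.
have cg : c (xget 1%g c) by case: xgetP => // /(_ _ (coset_repP cc)).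
have [m mE] := coset_mem cc.1 (coset_repP cc) cg.
rewrite -mE -[in RHS](x_fixed m) tensor_map_comp; apply: eq_tensor_map => u /=.
  exact: Tbar_equivariant.
by rewrite pi_rep.2.
Qed.

Lemma contract_ind_vector l : contract l ind_vector =
  \sum_(c <- fset_set double_cosets) right_trans (coset_rep c)
     (frob_Tbar (contract (l \o pi (i (coset_rep c) * t)%g) x)).
Proof.
by rewrite ind_vectorE linear_sum; apply: eq_bigr => c _; rewrite /= contract_map.
Qed.

Lemma ind_vector_neq0 : irreducible_rep rhoK -> x <> 0 -> ind_vector <> 0.
Proof.
move=> irr x0 Y0; have ev_lin : linear (fun phi : K -> V => phi 1%g) by [].
pose ev : {linear (K -> V) -> V} := linear_of ev_lin.
pose c0 := [set (t * i h)%g | h in [set: K]].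
have cc0 : double_cosets c0.
  by split; [exists t|exists 1%g, 1%g; rewrite // int_to_local1 mulg1 mul1g].
have : tensor_map ev idfun ind_vector = 0 by rewrite Y0 linear0.
rewrite ind_vectorE linear_sum (bigD1_seq c0) ?fset_uniq ?in_fset_set ?mem_set //=.
rewrite big_seq_cond big1 ?addr0.
  rewrite (@ind_term_rep _ 1%g) //; last first.
    by exists 1%g; rewrite // int_to_local1 mulg1 mul1g.
  rewrite /ind_term tensor_map_comp => T0.
  have [v Tv] : exists v, Tbar t v <> 0.
    suff : hecke_support Tbar t by [].
    by rewrite Tbar_support; exists 1%g, 1%g; rewrite int_to_local1 mulg1 mul1g.
  apply: x0; apply: (tensor_map_eq0_irreducible irr x_fixed (ex_intro _ v Tv)).
  (* Applying id (x) t^-1 to (Tbar(t) (x) t) x = 0 leaves (Tbar(t) (x) id) x = 0. *)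
  have := congr1 (tensor_map idfun (pi t^-1%g)) T0.
  rewrite linear0 tensor_map_comp => <-; apply: eq_tensor_map => u /=.
    rewrite -[RHS]/(frob_Tbar u (1 * 1)%g) mulg1 frob_TbarE asboolT ?inflation_rep.1 //.
    exact: K_cap_conj1.
  by rewrite int_to_local1 mul1g -pi_rep.2 mulVg pi_rep.1.
(* At 1 the translate of A u by h takes the value (A u)(h), which is 0 unless h is in tKt^-1, that
   is, unless h t K = tK. *)
move=> c /andP[]; rewrite in_fset_set // => /set_mem cc /eqP cc0'.
rewrite /ind_term tensor_map_comp.
apply: contract_eq0 => l; rewrite contract_map.
rewrite -[LHS]/(frob_Tbar _ (1 * coset_rep c)%g) mul1g frob_TbarE asboolF //.
move=> [m cm]; apply: cc0'.
have := coset_repP cc; rewrite cm mulgVK; move: cc => [[g ->] _] [n _ gn].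
apply/seteqP; split=> _ [q _ <-].
  exists (m * n^-1 * q)%g => //.
  by rewrite !int_to_localM int_to_localV !mulgA -gn mulgK.
exists (n * m^-1 * q)%g => //.
by rewrite !int_to_localM int_to_localV !mulgA gn mulgK.
Qed.

Section FrobeniusMap.
Variable Phi : (K -> V) -> V.
Hypothesis Phi_frobenius : is_frobenius_map rho t Nminus Phi.

(** Equivariance and the adjunction give Phi (h A u) = h Tbar(t) u, so Phi maps each contraction of
    the vector to the same contraction of Tbar x. *)
Lemma ind_vector_kernel : hecke_act pi Tbar x = 0 ->
  supported ind_vector `<=` [set phi | induced rho t Nminus phi /\ Phi phi = 0].
Proof.
have [PhiL PhiR PhiF] := Phi_frobenius.
move=> Tx _ [l ->]; have := congr1 (contract l) Tx; rewrite hecke_actE linear_sum linear0.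
rewrite contract_ind_vector => <- /=.
have Phi0 : Phi 0 = 0.
  have := PhiL (- 1) 0 0 induced_submod.1 induced_submod.1.
  by rewrite scaler0 addr0 scaleN1r addNr.
(* Phi is linear only on the induced module, so membership is carried along the sum. *)
elim: (fset_set double_cosets : seq _) => [|c s [IHi IHp]].
  by rewrite !big_nil; split=> //; exact: induced_submod.1.
rewrite !big_cons; set phi := right_trans _ _.
have phi_ind : induced rho t Nminus phi by apply: induced_trans; exact: frob_Tbar_induced.
split; first exact: submodD induced_submod _ _.
rewrite -{1}[phi]scale1r PhiL // scale1r IHp contract_map /=; congr (_ + _).
rewrite [LHS]PhiR; last exact: frob_Tbar_induced.
by rewrite PhiF.
Qed.
End FrobeniusMap.
End FixedVector.

End HeckeKernel.

Theorem corollary2p3p3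
  (p : nat) (p_pr : prime p) (F : fieldExtType (Qp p_pr))
  (w : integers F) (w_unif : uniformizer w)
  (k : finFieldType) (red : {rmorphism integers F -> k})
  (red_residue : residue_field_map red)
  (C : closedFieldType) (iota : {rmorphism k -> C})
  (C_closure : forall z : C, algebraicOver iota z)
  (G T : group_scheme (integers F)) (j : {lrmorphism G -> T})
  (G_reductive : reductive G) (T_torus : split_maximal_torus j)
  (l : nat) (Delta : 'I_l -> character T) (Delta_simple : simple_roots j Delta)
  (V : lmodType C) (rho : points G (alg_along red) -> {linear V -> V})
  (V_weight : irreducible_rep rho)
  (W : lmodType C) (pi : local_points G -> {linear W -> W})
  (pi_smooth : smooth_rep pi)
  (mu : cochar T) (mu_anti : antidominant Delta mu)
  (t : local_points G)
  (t_def : t = on_points j (mu (alg_along (int_incl F)) (unit_of (int_incl F w))))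
  (* unipotent radicals of P_mu and P_{-mu} over the algebraic closure of k *)
  (Nplus Nminus : set (points G (alg_along (iota \o red))))
  (Nplus_rad : is_unipotent_radical (parabolic j mu (iota \o red)) Nplus)
  (Nminus_rad :
     is_unipotent_radical (parabolic j (cochar_opp mu) (iota \o red)) Nminus)
  (Tbar : local_points G -> {linear V -> V})
  (Tbar_def : is_Tbar rho t (k_points Nplus) (k_points Nminus) Tbar)
  (Phi : (integral_points G -> V) -> V)
  (Phi_frobenius : is_frobenius_map rho t (k_points Nminus) Phi) :
  ~ set_inj (tensor_fixed (inflation rho) (restriction pi)) (hecke_act pi Tbar) ->
  exists (V' : lmodType C) (rho' : integral_points G -> {linear V' -> V'}),
    irreducible_constituent (@right_translation _ _ _ _ _ V)
      [set phi | induced rho t (k_points Nminus) phi /\ Phi phi = 0] rho' /\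
    exists x : tensor V' W, tensor_fixed rho' (restriction pi) x /\ x <> 0.
Proof.
move=> not_inj.
have [ftG smG _] := G_reductive.
have [rho_rep [[v0 v0n] rho_irr]] := V_weight; have [pi_rep _] := pi_smooth.
have [Tbar_hecke Tbar_support Tbar_val] := Tbar_def.
have Tbar_fixed v : fixed rho (k_points Nminus) (Tbar t v) := (Tbar_val v).1.
have irr : irreducible_rep (inflation rho).
  split; first exact: inflation_rep.
  split; first by exists v0.
  move=> U sU stU; apply: rho_irr => // g u Uu.
  by have [h <-] := reduction_surjective w_unif red_residue smG g; exact: stU.
have double_cosets_finite : finite_set (double_cosets t).
  apply: sub_finite_set (compact_finite_cosets ftG Tbar_hecke.1) => c [lc [h ch]].
  split=> //; exists (int_to_local h * t)%g; split=> //; rewrite Tbar_support.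
  by exists h, 1%g; rewrite int_to_local1 mulg1.
have [x [fx Tx x0]] : exists x, [/\ tensor_fixed (inflation rho) (restriction pi) x,
    hecke_act pi Tbar x = 0 & x <> 0].
  apply: contrapT => no_x; apply: not_inj => x y /set_mem fx /set_mem fy Txy.
  apply/eqP; rewrite -subr_eq0; apply/eqP; apply: contrapT => xy0; apply: no_x.
  have fxy : tensor_fixed (inflation rho) (restriction pi) (x - y).
    by move=> h; rewrite linearB /= fx fy.
  exists (x - y); split=> //.
  (* Additivity of the operator on fixed vectors is read off its expression as a finite sum over
     common representatives. *)
  rewrite (hecke_actE pi_rep Tbar_hecke Tbar_support fxy double_cosets_finite).
  rewrite -[RHS](subrr (hecke_act pi Tbar x)) {2}Txy.
  rewrite !(hecke_actE pi_rep Tbar_hecke Tbar_support _ double_cosets_finite) // -sumrB.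
  by apply: eq_bigr => c _; rewrite linearB.
have Y0 := ind_vector_neq0 rho_rep pi_rep Tbar_hecke Tbar_support fx double_cosets_finite irr x0.
have fY := ind_vector_fixed rho_rep pi_rep Tbar_hecke fx double_cosets_finite.
have Yker := ind_vector_kernel rho_rep pi_rep Tbar_hecke Tbar_support Tbar_fixed fx
  double_cosets_finite Phi_frobenius Tx.
exact: fixed_irreducible_constituent (@right_trans_rep _ _ _ _ _ _) fY Y0 Yker.
Qed.
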